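(* The sharp $\mathscr{S}^*_{\wp,n}$-radius of the class $\mathcal{F}_n$ is $R_{\mathscr{S}^*_{\wp,n}}(\mathcal{F}_n)=\left(\sqrt{1+n^2e^2}-ne\right)^{1/n}$. In particular ($n=1$), the $\mathscr{S}^*_\wp$-radius of $\mathcal{F}=\{f\in\mathcal{A}:\operatorname{Re}(f(z)/z)>0\}$ is $\sqrt{1+e^2}-e$.
   Context: $\mathbb{D}$ is the unit disk. For $n\ge1$, $\mathcal{A}_n$ is the class of analytic $f$ on $\mathbb{D}$ of the form $f(z)=z+\sum_{k\ge n+1}b_kz^k$, $\mathcal{A}=\mathcal{A}_1$. $f\prec g$ means $f=g\circ\omega$ for analytic $\omega:\mathbb{D}\to\mathbb{D}$, $\omega(0)=0$. $\wp(z)=1+ze^z$, $\mathscr{S}^*_\wp=\{f\in\mathcal{A}:zf'/f\prec\wp\}$, $\mathscr{S}^*_{\wp,n}=\mathcal{A}_n\cap\mathscr{S}^*_\wp$. $\mathcal{P}_n$ is the class of analytic $p(z)=1+\sum_{k\ge n}c_kz^k$ with $\operatorname{Re}p>0$ on $\mathbb{D}$, and $\mathcal{F}_n=\{f\in\mathcal{A}_n: f(z)/z\in\mathcal{P}_n\}$. For classes $G_1,G_2$, the $G_1$-radius $R_{G_1}(G_2)$ is the largest $r_0\in(0,1]$ such that $r^{-1}f(rz)\in G_1$ for all $0<r\le r_0$ and all $f\in G_2$; ''sharp'' means this number cannot be increased (some $f\in G_2$ fails beyond it). *)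

(* Defs.v *)
From Stdlib Require Import Reals.
From Coquelicot Require Import Coquelicot.
Open Scope R_scope.

Definition in_disk (z : Complex.C) : Prop := Cmod z < 1.

Definition analytic_on_disk (f : Complex.C -> Complex.C) : Prop :=
  forall z, in_disk z ->
    ex_derive (K := C_AbsRing) (V := C_NormedModule) f z.

Definition Cexp (z : Complex.C) : Complex.C :=
  (RtoC (exp (Re z)) * (RtoC (cos (Im z)) + Ci * RtoC (sin (Im z))))%C.

Definition wp (z : Complex.C) : Complex.C := (1 + z * Cexp z)%C.

Definition has_expansion (f : Complex.C -> Complex.C) (b : nat -> Complex.C) : Prop :=
  forall z, in_disk z ->
    is_pseries (K := C_AbsRing) (V := C_NormedModule) b z (f z).

Definition class_A (n : nat) (f : Complex.C -> Complex.C) : Prop :=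
  analytic_on_disk f /\
  exists b : nat -> Complex.C,
    has_expansion f b /\ b 0%nat = 0%C /\ b 1%nat = 1%C /\
    (forall k, (2 <= k <= n)%nat -> b k = 0%C).

Definition class_P (n : nat) (p : Complex.C -> Complex.C) : Prop :=
  analytic_on_disk p /\
  (exists c : nat -> Complex.C,
    has_expansion p c /\ c 0%nat = 1%C /\
    (forall k, (1 <= k < n)%nat -> c k = 0%C)) /\
  (forall z, in_disk z -> 0 < Re (p z)).

(* F_n = { f in A_n : f(z)/z in P_n }, the function f(z)/z being taken with its
   removable value at 0, i.e. f(z) = z p(z) on D with p in P_n. *)
Definition class_F (n : nat) (f : Complex.C -> Complex.C) : Prop :=
  class_A n f /\
  exists p, class_P n p /\ forall z, in_disk z -> f z = (z * p z)%C.

Definition schwarz (w : Complex.C -> Complex.C) : Prop :=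
  analytic_on_disk w /\ w 0%C = 0%C /\ (forall z, in_disk z -> in_disk (w z)).

(* S*_wp : f in A with z f'(z)/f(z) << wp.  The function z f'/f is analytic on D
   (so f(z) <> 0 for z <> 0), its value at 0 being the removable one. *)
Definition class_S_wp (f : Complex.C -> Complex.C) : Prop :=
  class_A 1 f /\
  exists w, schwarz w /\
    forall z, in_disk z -> z <> 0%C ->
      exists d : Complex.C,
        is_derive (K := C_AbsRing) (V := C_NormedModule) f z d /\
        f z <> 0%C /\ (z * d / f z)%C = wp (w z).

Definition class_S_wp_n (n : nat) (f : Complex.C -> Complex.C) : Prop :=
  class_A n f /\ class_S_wp f.

Definition dilate (r : R) (f : Complex.C -> Complex.C) : Complex.C -> Complex.C :=
  fun z => (f (RtoC r * z) / RtoC r)%C.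

Definition radius_prop (G1 G2 : (Complex.C -> Complex.C) -> Prop) (r0 : R) : Prop :=
  forall r, 0 < r <= r0 -> forall f, G2 f -> G1 (dilate r f).

Definition is_radius (G1 G2 : (Complex.C -> Complex.C) -> Prop) (r0 : R) : Prop :=
  0 < r0 <= 1 /\ radius_prop G1 G2 r0 /\
  (forall r1, r0 < r1 <= 1 -> ~ radius_prop G1 G2 r1).

(* Main.v *)
Require Import Defs.
From Stdlib Require Import Reals Lra Lia Psatz Classical ClassicalEpsilon.
From Coquelicot Require Import Coquelicot.
Open Scope R_scope.

(** Writing [f = z p], subordination of [z f' / f = 1 + z p' / p] to [1 + z e^z] means solving
    [w e^w = z p' / p] with [w] analytic and [|w| < 1].  On [|u| < 1/e] the equation [w e^w = u]
    is solved by the fixed point of the contraction [w |-> u e^(-w)], so it suffices that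
    [|z p' / p| < 1/e], which follows from [|z p'| <= 2 n r^n Re p / (1 - r^(2n))].
    This last bound is proved in the manner of Ahlfors' lemma: with [p' = z^(n-1) q], at an
    interior maximum of [|q| (rad^(2n) - |z|^(2n)) / Re p] the Laplacian of the logarithm is
    nonpositive, and that inequality is the bound.  For sharpness take [p = (1 - z^n) / (1 + z^n)]:
    at positive [z] the quantity [z p' / p] is real, it drops below [-1/e] beyond the radius, and
    [w e^w] takes no real value below [-1/e] on the disk. *)

(** * Complex derivatives *)

(** The constant 1/e is the radius of the largest disk about 0 contained in the image of the unit
    disk under w e^w: t e^(-t) increases to 1/e on [0, 1), and the value -1/e is reached only at the
    boundary point w = -1. The extremal p pushes z p' / p exactly towards that point, so both halves
    of the proof lead to the same equation 2 n t / (1 - t^2) = 1/e for t = r^n, with positive root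
    sqrt(1 + n^2 e^2) - n e.

    The factor r^n in the derivative estimate reflects that p' vanishes to order n - 1 at 0. To keep
    this order, |p'| / Re p is compared with the hyperbolic metric pulled back along z^n. Both
    metrics then vanish at 0, where their logarithms are undefined, which is why z^(n-1) is divided
    out of p' first. The weight is taken on a smaller disk of radius rad so that it vanishes on the
    bounding circle: a nonzero maximum is then interior, and rad tends to 1 only at the end. *)

Definition is_Cderive (f : C -> C) (z l : C) : Prop :=
  is_derive (K := C_AbsRing) (V := C_NormedModule) f z l.

(** The classes use [C_NormedModule], while the product, chain and identity rules are stated over
    [AbsRing_NormedModule C_AbsRing]. The two differ as structures, but a derivative only sees
    operations that agree by conversion, so repacking the fields is enough. *)
Lemma is_Cderive_AbsRing (f : C -> C) (z l : C) :
  is_Cderive f z l <->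
  is_derive (K := C_AbsRing) (V := AbsRing_NormedModule C_AbsRing) f z l.
Proof.
  split; intros [[H1 H2 H3] H4]; (split; [split; [exact H1|exact H2|exact H3]|exact H4]).
Qed.

Lemma is_Cderive_eps (f : C -> C) (z l : C) :
  is_Cderive f z l <->
  forall eps, 0 < eps -> exists delta, 0 < delta /\ forall w, Cmod (w - z) < delta ->
    Cmod (f w - f z - l * (w - z)) <= eps * Cmod (w - z).
Proof.
  split.
  - intros [_ H] eps Heps.
    assert (Hl : is_filter_lim (locally (T := AbsRing_UniformSpace C_AbsRing) z) z) by (intros P HP; exact HP).
    destruct (H z Hl (mkposreal eps Heps)) as [d Hd].
    exists d; split; [apply cond_pos|]. intros w Hw.
    generalize (Hd w Hw); simpl.
    replace (f w - f z - l * (w - z))%C with (minus (minus (f w) (f z)) (scal (minus w z) l)).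
    + intros HH; exact HH.
    + unfold minus, plus, opp, scal; simpl. unfold mult; simpl. ring.
  - intros H. split.
    + apply (is_linear_scal_l (K := C_AbsRing) (V := C_NormedModule) l).
    + intros x Hx.
      replace x with z by (apply (is_filter_lim_locally_unique (K := C_AbsRing) (V := AbsRing_NormedModule C_AbsRing)); exact Hx).
      intros eps. destruct (H eps (cond_pos eps)) as [d [Hd Hd']].
      exists (mkposreal d Hd). intros w Hw. simpl in Hw.
      generalize (Hd' w Hw).
      replace (f w - f z - l * (w - z))%C with (minus (minus (f w) (f z)) (scal (minus w z) l)).
      * intros HH; exact HH.
      * unfold minus, plus, opp, scal; simpl. unfold mult; simpl. ring.
Qed.

Lemma is_Cderive_unique (f : C -> C) (z l1 l2 : C) :
  is_Cderive f z l1 -> is_Cderive f z l2 -> l1 = l2.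
Proof.
  intros H1 H2. rewrite <- (is_C_derive_unique f z l1), <- (is_C_derive_unique f z l2); auto.
Qed.

Lemma is_Cderive_ext (f g : C -> C) (z l : C) :
  (forall w, f w = g w) -> is_Cderive f z l -> is_Cderive g z l.
Proof. intros H; apply is_derive_ext; exact H. Qed.

Lemma is_Cderive_ext_disk (f g : C -> C) (z l : C) :
  in_disk z -> (forall w, in_disk w -> f w = g w) -> is_Cderive f z l -> is_Cderive g z l.
Proof.
  unfold in_disk. intros Hz Hfg H. apply is_Cderive_eps. intros eps He.
  destruct (proj1 (is_Cderive_eps f z l) H eps He) as [d [Hd Hd']].
  exists (Rmin d (1 - Cmod z)). split; [apply Rmin_pos; lra|].
  intros w Hw. assert (Hw1 := Rlt_le_trans _ _ _ Hw (Rmin_l _ _)).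
  assert (Hw2 := Rlt_le_trans _ _ _ Hw (Rmin_r _ _)).
  rewrite <- (Hfg z Hz), <- (Hfg w); [apply Hd'; exact Hw1|].
  replace w with ((w - z) + z)%C by ring. generalize (Cmod_triangle (w - z) z). lra.
Qed.

Lemma is_Cderive_const (c z : C) : is_Cderive (fun _ => c) z 0%C.
Proof. apply (is_derive_const (K := C_AbsRing) (V := C_NormedModule)). Qed.

Lemma is_Cderive_id (z : C) : is_Cderive (fun w => w) z 1%C.
Proof. apply is_Cderive_AbsRing, (is_derive_id (K := C_AbsRing)). Qed.

Lemma is_Cderive_plus (f g : C -> C) (z a b : C) :
  is_Cderive f z a -> is_Cderive g z b -> is_Cderive (fun w => f w + g w)%C z (a + b)%C.
Proof. apply (is_derive_plus (K := C_AbsRing) (V := C_NormedModule)). Qed.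

Lemma is_Cderive_mult (f g : C -> C) (z a b : C) :
  is_Cderive f z a -> is_Cderive g z b ->
  is_Cderive (fun w => f w * g w)%C z (a * g z + f z * b)%C.
Proof.
  rewrite !is_Cderive_AbsRing. intros Hf Hg.
  apply (is_derive_mult (K := C_AbsRing)); auto. exact Cmult_comm.
Qed.

Lemma is_Cderive_scal (k : C) (f : C -> C) (z a : C) :
  is_Cderive f z a -> is_Cderive (fun w => k * f w)%C z (k * a)%C.
Proof.
  intros H. generalize (is_Cderive_mult (fun _ => k) f z 0%C a (is_Cderive_const k z) H).
  replace (0 * f z + k * a)%C with (k * a)%C by ring. auto.
Qed.

Lemma is_Cderive_comp (f g : C -> C) (z a b : C) :
  is_Cderive f (g z) a -> is_Cderive g z b -> is_Cderive (fun w => f (g w)) z (a * b)%C.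
Proof.
  intros Hf Hg. apply is_Cderive_AbsRing in Hg. rewrite Cmult_comm.
  apply (is_derive_comp (K := C_AbsRing) (V := C_NormedModule) f g); auto.
Qed.

Lemma is_Cderive_continuous (f : C -> C) (z l : C) :
  is_Cderive f z l ->
  forall eps, 0 < eps -> exists delta, 0 < delta /\ forall w, Cmod (w - z) < delta ->
    Cmod (f w - f z) < eps.
Proof.
  intros H eps He.
  destruct (proj1 (is_Cderive_eps f z l) H 1 Rlt_0_1) as [d [Hd Hd']].
  assert (Hl := Cmod_ge_0 l).
  exists (Rmin d (eps / (2 + Cmod l))).
  assert (0 < eps / (2 + Cmod l)) by (apply Rdiv_lt_0_compat; lra).
  split; [apply Rmin_pos; auto|].
  intros w Hw. assert (Hw1 := Rlt_le_trans _ _ _ Hw (Rmin_l _ _)).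
  assert (Hw2 := Rlt_le_trans _ _ _ Hw (Rmin_r _ _)).
  specialize (Hd' w Hw1).
  replace (f w - f z)%C with ((f w - f z - l * (w - z)) + l * (w - z))%C by ring.
  eapply Rle_lt_trans; [apply Cmod_triangle|]. rewrite Cmod_mult.
  apply Rmult_lt_compat_r with (r := 2 + Cmod l) in Hw2; [|lra].
  replace (eps / (2 + Cmod l) * (2 + Cmod l)) with eps in Hw2 by (field; lra).
  generalize (Cmod_ge_0 (w - z)). nra.
Qed.

Lemma is_Cderive_inv_id (z : C) : z <> 0%C -> is_Cderive Cinv z (- / (z * z))%C.
Proof.
  intros Hz. apply is_Cderive_eps. intros eps He.
  assert (Hm : 0 < Cmod z) by (apply Cmod_gt_0; auto).
  set (m := Cmod z) in *.
  exists (Rmin (m / 2) (eps * m ^ 3 / 2)).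
  split; [apply Rmin_pos; [lra|]; apply Rdiv_lt_0_compat; [|lra]; apply Rmult_lt_0_compat; auto; apply pow_lt; auto|].
  intros w Hw. assert (Hw1 := Rlt_le_trans _ _ _ Hw (Rmin_l _ _)).
  assert (Hw2 := Rlt_le_trans _ _ _ Hw (Rmin_r _ _)).
  assert (Hmw : m / 2 < Cmod w).
  { assert (m <= Cmod w + Cmod (w - z)); [|lra].
    unfold m. replace z with (w + - (w - z))%C at 1 by ring.
    eapply Rle_trans; [apply Cmod_triangle|]. rewrite Cmod_opp. lra. }
  assert (Hw0 : w <> 0%C) by (apply Cmod_gt_0; lra).
  replace (/ w - / z - - / (z * z) * (w - z))%C with ((w - z) * (w - z) * / (w * (z * z)))%C
    by (field; auto).
  rewrite !Cmod_mult, Cmod_inv, !Cmod_mult by (repeat apply Cmult_neq_0; auto). fold m.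
  set (h := Cmod (w - z)) in *.
  assert (Hh : 0 <= h) by apply Cmod_ge_0.
  assert (Hmm : 0 < Cmod w * (m * m)) by (repeat apply Rmult_lt_0_compat; lra).
  assert (h * / (Cmod w * (m * m)) <= eps); [|nra].
  apply Rmult_le_reg_r with (Cmod w * (m * m)); [exact Hmm|].
  rewrite Rmult_assoc, Rinv_l by lra.
  apply Rle_trans with (eps * m ^ 3 / 2); [lra|].
  simpl. assert (0 < m * m) by nra. assert (0 < eps * (m * m)) by nra. nra.
Qed.

Lemma is_Cderive_div (f g : C -> C) (z a b : C) :
  g z <> 0%C -> is_Cderive f z a -> is_Cderive g z b ->
  is_Cderive (fun w => f w / g w)%C z ((a * g z - f z * b) / (g z * g z))%C.
Proof.
  intros Hz Hf Hg. unfold Cdiv.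
  assert (Hi := is_Cderive_comp Cinv g z _ _ (is_Cderive_inv_id (g z) Hz) Hg).
  generalize (is_Cderive_mult f (fun w => / g w)%C z _ _ Hf Hi).
  replace (a * / g z + f z * (- / (g z * g z) * b))%C
     with ((a * g z - f z * b) * / (g z * g z))%C by (field; auto). auto.
Qed.

Lemma is_Cderive_pow (n : nat) (z : C) :
  is_Cderive (fun w => w ^ n)%C z (RtoC (INR n) * z ^ (n - 1))%C.
Proof.
  induction n as [|n IH].
  - simpl. rewrite Cmult_0_l. apply (is_Cderive_const 1%C).
  - generalize (is_Cderive_mult (fun w => w) (fun w => w ^ n)%C z _ _ (is_Cderive_id z) IH).
    intros H.
    replace (RtoC (INR (S n)) * z ^ (S n - 1))%C
      with (1 * z ^ n + z * (RtoC (INR n) * z ^ (n - 1)))%C; [exact H|].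
    rewrite S_INR, RtoC_plus. replace (S n - 1)%nat with n by lia.
    destruct n; [simpl; ring|]. replace (S n - 1)%nat with n by lia.
    rewrite Cpow_S. ring.
Qed.

(** The bridge to one-variable real calculus. Imaginary parts are reached by applying it to -i f. *)
Lemma is_Cderive_line (f : C -> C) (z d l : C) (t : R) :
  is_Cderive f (z + RtoC t * d)%C l ->
  is_derive (fun s : R => Re (f (z + RtoC s * d)%C)) t (Re (l * d)%C).
Proof.
  intros H. split; [apply (is_linear_scal_l (K := R_AbsRing) (V := R_NormedModule))|].
  intros x Hx. apply (is_filter_lim_locally_unique (K := R_AbsRing) (V := R_NormedModule)) in Hx.
  subst x. intros eps.
  assert (Hd0 := Cmod_ge_0 d).
  assert (He : 0 < eps / (1 + Cmod d)) by (apply Rdiv_lt_0_compat; [apply cond_pos|lra]).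
  destruct (proj1 (is_Cderive_eps _ _ _) H _ He) as [r [Hr Hr']].
  assert (Hr2 : 0 < r / (1 + Cmod d)) by (apply Rdiv_lt_0_compat; lra).
  exists (mkposreal _ Hr2). intros s Hs.
  change (Rabs (s - t) < r / (1 + Cmod d)) in Hs.
  change (Rabs (Re (f (z + RtoC s * d)%C) - Re (f (z + RtoC t * d)%C) - (s - t) * Re (l * d)%C)
    <= eps * Rabs (s - t)).
  assert (E : (z + RtoC s * d - (z + RtoC t * d))%C = (RtoC (s - t) * d)%C)
    by (rewrite RtoC_minus; ring).
  specialize (Hr' (z + RtoC s * d)%C). rewrite E, Cmod_mult, Cmod_R in Hr'.
  apply Rmult_lt_compat_r with (r := 1 + Cmod d) in Hs; [|lra].
  replace (r / (1 + Cmod d) * (1 + Cmod d)) with r in Hs by (field; lra).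
  generalize (Rabs_pos (s - t)); intros Hp.
  assert (Hr1 : Rabs (s - t) * Cmod d < r) by nra.
  specialize (Hr' Hr1).
  replace (Re (f (z + RtoC s * d)%C) - Re (f (z + RtoC t * d)%C) - (s - t) * Re (l * d)%C)
    with (Re (f (z + RtoC s * d) - f (z + RtoC t * d) - l * (RtoC (s - t) * d))%C).
  2:{ replace (l * (RtoC (s - t) * d))%C with (RtoC (s - t) * (l * d))%C by ring.
      unfold Cminus. rewrite !re_plus, !re_opp, re_scal_l. ring. }
  eapply Rle_trans; [apply re_le_Cmod|]. eapply Rle_trans; [apply Hr'|].
  replace (eps / (1 + Cmod d) * (Rabs (s - t) * Cmod d))
    with (eps * Rabs (s - t) * (Cmod d / (1 + Cmod d))) by (field; lra).
  assert (Cmod d / (1 + Cmod d) <= 1) by (apply Rmult_le_reg_r with (1 + Cmod d); [lra|]; unfold Rdiv; rewrite Rmult_assoc, Rinv_l; lra).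
  generalize (cond_pos eps). intros. assert (0 <= eps * Rabs (s - t)) by nra. nra.
Qed.

(** * Power series on the unit disk *)

Definition is_Cseries (a : nat -> C) (l : C) : Prop :=
  is_series (K := C_AbsRing) (V := C_NormedModule) a l.

Lemma pow_n_Cpow (z : C) (k : nat) : pow_n (K := C_Ring) z k = (z ^ k)%C.
Proof. induction k as [|k IH]; [reflexivity|]. rewrite Cpow_S, <- IH. reflexivity. Qed.

Lemma is_pseries_Cseries (b : nat -> C) (z l : C) :
  is_pseries (K := C_AbsRing) (V := C_NormedModule) b z l <->
  is_Cseries (fun k => b k * z ^ k)%C l.
Proof.
  assert (E : forall k, scal (V := C_ModuleSpace) (pow_n (K := C_Ring) z k) (b k) = (b k * z ^ k)%C).
  { intros k. transitivity (pow_n (K := C_Ring) z k * b k)%C; [reflexivity|].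
    rewrite pow_n_Cpow. apply Cmult_comm. }
  unfold is_pseries, is_Cseries.
  split; apply is_series_ext; intros k; [|symmetry]; apply E.
Qed.

Lemma is_Cseries_ext (a b : nat -> C) (l : C) :
  (forall k, a k = b k) -> is_Cseries a l -> is_Cseries b l.
Proof. apply (is_series_ext (K := C_AbsRing) (V := C_NormedModule)). Qed.

Lemma is_Cseries_plus (a b : nat -> C) (la lb : C) :
  is_Cseries a la -> is_Cseries b lb -> is_Cseries (fun k => a k + b k)%C (la + lb)%C.
Proof. apply (is_series_plus (K := C_AbsRing) (V := C_NormedModule)). Qed.

Lemma is_Cseries_scal (c : C) (a : nat -> C) (l : C) :
  is_Cseries a l -> is_Cseries (fun k => c * a k)%C (c * l)%C.
Proof. apply (is_series_scal (K := C_AbsRing) (V := C_NormedModule)). Qed.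

Lemma is_Cseries_shift (a : nat -> C) (l : C) :
  is_Cseries (fun k => a (S k)) l <-> is_Cseries a (a 0%nat + l)%C.
Proof.
  split; intros H.
  - apply (is_series_decr_1 (K := C_AbsRing) (V := C_NormedModule)).
    match goal with |- is_series _ ?x => replace x with l end; [exact H|].
    change (l = a 0%nat + l + - a 0%nat)%C. ring.
  - apply (is_series_incr_1 (K := C_AbsRing) (V := C_NormedModule)).
    match goal with |- is_series _ ?x => replace x with (a 0%nat + l)%C end; [exact H|].
    change (a 0%nat + l = l + a 0%nat)%C. ring.
Qed.

Lemma is_Cseries_unique (a : nat -> C) (l l' : C) :
  is_Cseries a l -> is_Cseries a l' -> l = l'.
Proof. apply (filterlim_locally_unique (K := C_AbsRing) (V := C_NormedModule)). Qed.

Lemma Cmod_sum_n_le (a : nat -> C) (b : nat -> R) (n : nat) :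
  (forall k, Cmod (a k) <= b k) ->
  Cmod (sum_n (G := C_AbelianMonoid) a n) <= sum_n b n.
Proof.
  intros H. induction n as [|n IH].
  - rewrite !sum_O. apply H.
  - rewrite !sum_Sn.
    eapply Rle_trans; [apply Cmod_triangle|].
    apply Rplus_le_compat; [exact IH|apply H].
Qed.

Lemma Cmod_Cseries_le (a : nat -> C) (b : nat -> R) (l : C) (L : R) :
  is_Cseries a l -> is_series b L -> (forall k, Cmod (a k) <= b k) -> Cmod l <= L.
Proof.
  intros Ha Hb H.
  assert (Hn : is_lim_seq (fun n => Cmod (sum_n (G := C_AbelianMonoid) a n)) (Cmod l)).
  { change (filterlim (fun n => norm (V := C_NormedModule) (sum_n (G := C_AbelianMonoid) a n))
      eventually (locally (norm (V := C_NormedModule) l))).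
    eapply filterlim_comp; [exact Ha|apply (filterlim_norm (V := C_NormedModule))]. }
  apply (is_lim_seq_le (fun n => Cmod (sum_n (G := C_AbelianMonoid) a n)) (sum_n b) (Finite (Cmod l)) (Finite L)); [|exact Hn|exact Hb].
  intros n. apply Cmod_sum_n_le, H.
Qed.

Lemma ex_Cseries_le (a : nat -> C) (b : nat -> R) :
  (forall k, Cmod (a k) <= b k) -> ex_series b -> exists l, is_Cseries a l.
Proof. apply (ex_series_le (K := C_AbsRing) (V := C_CompleteNormedModule)). Qed.

Lemma is_Cseries_bounded (a : nat -> C) (l : C) :
  is_Cseries a l -> exists M, 0 < M /\ forall k, Cmod (a k) <= M.
Proof.
  intros H.
  assert (H1 : eventually (fun n => Cmod (sum_n (G := C_AbelianMonoid) a n - l)%C < 1)).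
  { apply (proj1 (filterlim_locally_ball_norm (K := C_AbsRing) (U := C_NormedModule) _ _) H
      (mkposreal 1 Rlt_0_1)). }
  destruct H1 as [N HN].
  assert (Hs : forall m, forall k, (k <= m)%nat -> Cmod (a k) <= sum_n (fun k => Cmod (a k)) m).
  { induction m as [|m IH]; intros k Hk.
    - replace k with 0%nat by lia. rewrite sum_O. lra.
    - rewrite sum_Sn. change (Cmod (a k) <= sum_n (fun k => Cmod (a k)) m + Cmod (a (S m))).
      destruct (Nat.eq_dec k (S m)) as [->|Hne].
      + assert (0 <= sum_n (fun k => Cmod (a k)) m); [|lra].
        eapply Rle_trans; [apply (Cmod_ge_0 (a 0%nat))|apply IH; lia].
      + generalize (Cmod_ge_0 (a (S m))) (IH k ltac:(lia)). lra. }
  (* Past [N], consecutive partial sums are both within 1 of [l], so a term is at most 2; the sum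
     covers the earlier terms. *)
  exists (2 + sum_n (fun k => Cmod (a k)) N).
  assert (Hp : 0 <= sum_n (fun k => Cmod (a k)) N)
    by (eapply Rle_trans; [apply (Cmod_ge_0 (a 0%nat))|apply Hs; lia]).
  split; [lra|]. intros k.
  destruct (Nat.le_gt_cases k N) as [Hk|Hk]; [generalize (Hs N k Hk); lra|].
  destruct k as [|k]; [lia|].
  assert (E : a (S k) = ((sum_n (G := C_AbelianMonoid) a (S k) - l)
                       + - (sum_n (G := C_AbelianMonoid) a k - l))%C).
  { rewrite sum_Sn. change plus with Cplus. ring. }
  rewrite E. eapply Rle_trans; [apply Cmod_triangle|]. rewrite Cmod_opp.
  generalize (HN (S k) ltac:(lia)) (HN k ltac:(lia)). lra.
Qed.

Lemma ex_series_sqr_geom (x : R) :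
  0 < x < 1 -> ex_series (fun k => (INR k + 1) ^ 2 * x ^ k).
Proof.
  intros Hx.
  assert (Hpos : forall n, 0 < (INR n + 1) ^ 2 * x ^ n).
  { intros n. generalize (pos_INR n); intros. apply Rmult_lt_0_compat; apply pow_lt; lra. }
  apply ex_series_ext with (fun k => Rabs ((INR k + 1) ^ 2 * x ^ k)).
  { intros n. apply Rabs_pos_eq, Rlt_le, Hpos. }
  apply ex_series_DAlembert with x; [lra| |].
  - intros n. generalize (Hpos n). lra.
  - apply is_lim_seq_ext with (fun n => (1 + / INR (S n)) * (1 + / INR (S n)) * x).
    { intros n. rewrite Rabs_pos_eq by (apply Rlt_le, Rdiv_lt_0_compat; apply Hpos).
      rewrite !S_INR. generalize (pos_INR n); intros.
      assert (x ^ n <> 0) by (apply pow_nonzero; lra). simpl. field. lra. }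
    assert (Hl : is_lim_seq (fun n => 1 + / INR (S n)) 1).
    { replace (Finite 1) with (Finite (1 + 0)) by (f_equal; ring).
      apply is_lim_seq_plus'; [apply is_lim_seq_const|].
      apply (is_lim_seq_incr_1 (fun n => / INR n)).
      apply (is_lim_seq_inv _ p_infty); [apply is_lim_seq_INR|discriminate]. }
    replace (Finite x) with (Finite (1 * 1 * x)) by (f_equal; ring).
    apply is_lim_seq_mult'; [apply is_lim_seq_mult'; exact Hl|apply is_lim_seq_const].
Qed.

(** Abel's lemma: convergence at a point [s] between [rho] and 1 bounds |b_k| s^k, and the ratio
    [rho / s] leaves a geometric series. The weight (k + 1)^2 dominates the factors k and k^2 that
    termwise differentiation and its Taylor remainder produce. *)
Lemma has_expansion_ex_series (f : C -> C) (b : nat -> C) (rho : R) :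
  has_expansion f b -> 0 < rho < 1 ->
  ex_series (fun k => Cmod (b k) * ((INR k + 1) ^ 2 * rho ^ k)).
Proof.
  intros Hf Hr. set (s := (1 + rho) / 2).
  assert (Hs : in_disk (RtoC s)) by (unfold in_disk; rewrite Cmod_R, Rabs_pos_eq; unfold s; lra).
  specialize (Hf _ Hs). apply is_pseries_Cseries, is_Cseries_bounded in Hf.
  destruct Hf as [M [HM Hb]].
  assert (Hs0 : 0 < s) by (unfold s; lra).
  apply (ex_series_le (K := R_AbsRing) (V := R_CompleteNormedModule)) with
    (fun k => M * ((INR k + 1) ^ 2 * (rho / s) ^ k)).
  - intros k. change (Rabs (Cmod (b k) * ((INR k + 1) ^ 2 * rho ^ k))
      <= M * ((INR k + 1) ^ 2 * (rho / s) ^ k)).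
    specialize (Hb k). rewrite Cmod_mult, Cmod_pow, Cmod_R, Rabs_pos_eq in Hb by lra.
    assert (Hsk : 0 < s ^ k) by (apply pow_lt; lra).
    assert (Hrk : 0 < (rho / s) ^ k) by (apply pow_lt, Rdiv_lt_0_compat; lra).
    assert (0 <= (INR k + 1) ^ 2) by apply pow2_ge_0.
    replace (rho ^ k) with ((rho / s) ^ k * s ^ k)
      by (rewrite <- Rpow_mult_distr; f_equal; field; lra).
    assert (Hc := Cmod_ge_0 (b k)).
    rewrite Rabs_pos_eq by (apply Rmult_le_pos; [lra|apply Rmult_le_pos; [lra|apply Rmult_le_pos; lra]]).
    replace (Cmod (b k) * ((INR k + 1) ^ 2 * ((rho / s) ^ k * s ^ k)))
      with ((Cmod (b k) * s ^ k) * ((INR k + 1) ^ 2 * (rho / s) ^ k)) by ring.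
    apply Rmult_le_compat_r; [apply Rmult_le_pos; lra|exact Hb].
  - apply (ex_series_scal (K := R_AbsRing) (V := R_NormedModule) M).
    apply ex_series_sqr_geom. split; [apply Rdiv_lt_0_compat; lra|].
    apply Rmult_lt_reg_r with s; [lra|]. unfold Rdiv. rewrite Rmult_assoc, Rinv_l; unfold s in *; lra.
Qed.

Lemma Cpow_diff_bound (rho : R) (z w : C) (k : nat) :
  0 < rho -> Cmod z <= rho -> Cmod w <= rho ->
  Cmod (w ^ k - z ^ k) * rho <= INR k * rho ^ k * Cmod (w - z).
Proof.
  intros Hr Hz Hw. induction k as [|k IH].
  - simpl. replace (1 - 1)%C with (RtoC 0) by ring. rewrite Cmod_0. lra.
  - replace (w ^ S k - z ^ S k)%C with (w * (w ^ k - z ^ k) + (w - z) * z ^ k)%C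
      by (rewrite !Cpow_S; ring).
    assert (Hzk : Cmod (z ^ k) <= rho ^ k)
      by (rewrite Cmod_pow; apply pow_incr; split; [apply Cmod_ge_0|exact Hz]).
    generalize (Cmod_triangle (w * (w ^ k - z ^ k)) ((w - z) * z ^ k)).
    rewrite !Cmod_mult, S_INR. simpl.
    generalize (Cmod_ge_0 (w - z)) (Cmod_ge_0 w) (Cmod_ge_0 (w ^ k - z ^ k)). intros.
    assert (0 <= Cmod (w ^ k - z ^ k) * rho) by (apply Rmult_le_pos; lra).
    assert (Cmod w * (Cmod (w ^ k - z ^ k) * rho) <= rho * (INR k * rho ^ k * Cmod (w - z)))
      by (apply Rmult_le_compat; auto).
    assert (Cmod (w - z) * Cmod (z ^ k) <= Cmod (w - z) * rho ^ k)
      by (apply Rmult_le_compat_l; auto).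
    nra.
Qed.

(** Induction on the remainders: E_(k+1) = z E_k + (w - z) (w^k - z^k). The factor [rho ^ 2] on the
    left replaces an exponent k - 2 on the right, which would truncate for small k; in the same way
    [rho] stands for k - 1 in [Cpow_diff_bound]. *)
Lemma Cpow_taylor_bound (rho : R) (z w : C) (k : nat) :
  0 < rho -> Cmod z <= rho -> Cmod w <= rho ->
  Cmod (w ^ k - z ^ k - RtoC (INR k) * z ^ (k - 1) * (w - z)) * rho ^ 2
    <= INR k ^ 2 * rho ^ k * Cmod (w - z) ^ 2.
Proof.
  intros Hr Hz Hw. induction k as [|k IH].
  - simpl. replace (1 - 1 - 0 * 1 * (w - z))%C with (RtoC 0) by ring. rewrite Cmod_0. lra.
  - set (E := (w ^ k - z ^ k - RtoC (INR k) * z ^ (k - 1) * (w - z))%C) in *.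
    replace (w ^ S k - z ^ S k - RtoC (INR (S k)) * z ^ (S k - 1) * (w - z))%C
      with (z * E + (w - z) * (w ^ k - z ^ k))%C.
    2:{ unfold E. rewrite S_INR, RtoC_plus, !Cpow_S. replace (S k - 1)%nat with k by lia.
        destruct k as [|k]; [simpl; ring|]. replace (S k - 1)%nat with k by lia.
        rewrite !Cpow_S. ring. }
    generalize (Cmod_triangle (z * E) ((w - z) * (w ^ k - z ^ k))).
    rewrite !Cmod_mult, S_INR. simpl (rho ^ S k).
    generalize (Cpow_diff_bound rho z w k Hr Hz Hw).
    generalize (Cmod_ge_0 (w - z)) (Cmod_ge_0 z) (Cmod_ge_0 E) (Cmod_ge_0 (w ^ k - z ^ k)). intros.
    assert (Hrk : 0 < rho ^ k) by (apply pow_lt; lra).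
    assert (Hk := pos_INR k).
    assert (0 <= Cmod E * rho ^ 2) by (apply Rmult_le_pos; [lra|apply pow2_ge_0]).
    assert (Cmod z * (Cmod E * rho ^ 2) <= rho * (INR k ^ 2 * rho ^ k * Cmod (w - z) ^ 2))
      by (apply Rmult_le_compat; auto).
    assert (Cmod (w - z) * rho * (Cmod (w ^ k - z ^ k) * rho)
       <= Cmod (w - z) * rho * (INR k * rho ^ k * Cmod (w - z)))
      by (apply Rmult_le_compat_l; auto; apply Rmult_le_pos; lra).
    assert (0 <= (INR k + 1) * (rho * rho ^ k * Cmod (w - z) ^ 2)).
    { apply Rmult_le_pos; [lra|]. apply Rmult_le_pos; [|apply pow2_ge_0]. nra. }
    assert (0 < rho ^ 2) by (apply pow_lt; lra).
    apply Rle_trans with ((Cmod z * Cmod E + Cmod (w - z) * Cmod (w ^ k - z ^ k)) * rho ^ 2);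
      [apply Rmult_le_compat_r; lra|]. lra.
Qed.

(** Termwise differentiation: on the disk of radius [rho], halfway between |z| and 1, the Taylor
    remainders of the powers sum to at most K |w - z|^2 / rho^2. *)
Lemma Cseries_derivative (f : C -> C) (b : nat -> C) (z : C) :
  has_expansion f b -> in_disk z ->
  exists l, is_Cderive f z l /\
    is_Cseries (fun k => RtoC (INR (S k)) * b (S k) * z ^ k)%C l.
Proof.
  intros Hf Hz. unfold in_disk in Hz. assert (Hz0 := Cmod_ge_0 z).
  set (rho := (1 + Cmod z) / 2). assert (Hr : 0 < rho < 1) by (unfold rho; lra).
  assert (Hr2 : 0 < rho ^ 2) by (apply pow_lt; lra).
  assert (Hex := has_expansion_ex_series f b rho Hf Hr).
  destruct Hex as [K HK].
  assert (Hd : exists l, is_Cseries (fun k => RtoC (INR k) * b k * z ^ (k - 1))%C l).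
  { apply ex_Cseries_le with (fun k => / rho * (Cmod (b k) * ((INR k + 1) ^ 2 * rho ^ k))).
    - intros k. rewrite !Cmod_mult, Cmod_R, Cmod_pow, Rabs_pos_eq by apply pos_INR.
      generalize (pos_INR k) (Cmod_ge_0 (b k)); intros.
      apply Rmult_le_reg_l with rho; [lra|]. rewrite <- (Rmult_assoc rho (/ rho)), Rinv_r, Rmult_1_l by lra.
      destruct k as [|k].
      { simpl. rewrite Rmult_0_l, Rmult_0_l, Rmult_0_r. simpl in *. nra. }
      replace (S k - 1)%nat with k by lia. set (x := INR (S k)) in *.
      assert (Cmod z ^ k <= rho ^ k) by (apply pow_incr; unfold rho; lra).
      assert (0 <= Cmod z ^ k) by (apply pow_le; lra).
      assert (x <= (x + 1) ^ 2) by nra. simpl (rho ^ S k).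
      replace (rho * (x * Cmod (b (S k)) * Cmod z ^ k))
        with (Cmod (b (S k)) * (x * (rho * Cmod z ^ k))) by ring.
      apply Rmult_le_compat_l; [auto|]. apply Rmult_le_compat; auto.
      + apply Rmult_le_pos; lra.
      + apply Rmult_le_compat_l; lra.
    - apply (ex_series_scal (K := R_AbsRing) (V := R_NormedModule) (/ rho)). exists K; exact HK. }
  destruct Hd as [l Hl]. exists l.
  assert (Hl' := Hl).
  split.
  2:{ replace l with ((fun k => RtoC (INR k) * b k * z ^ (k - 1))%C 0%nat + l)%C in Hl'
        by (simpl; ring).
      apply is_Cseries_shift in Hl'. revert Hl'. apply is_Cseries_ext. intros k.
      replace (S k - 1)%nat with k by lia. reflexivity. }
  clear Hl'. apply is_Cderive_eps. intros eps He.
  (* [K] dominates |f 0|, whose series is compared term by term with that of [K]. *)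
  assert (HK0 : 0 <= K).
  { eapply Rle_trans; [apply (Cmod_ge_0 (f 0%C))|].
    eapply Cmod_Cseries_le; [apply (proj1 (is_pseries_Cseries b 0%C (f 0%C))), Hf; unfold in_disk; rewrite Cmod_0; lra|exact HK|].
    intros k. cbv beta. rewrite Cmod_mult. apply Rmult_le_compat_l; [apply Cmod_ge_0|].
    rewrite Cmod_pow, Cmod_0. generalize (pos_INR k) (pow_lt rho k ltac:(lra)); intros.
    destruct k; [simpl; lra|]. rewrite pow_i by lia.
    apply Rmult_le_pos; [apply pow2_ge_0|lra]. }
  (* The first bound keeps [w] in the disk of radius [rho], the second makes K |w - z| / rho^2 less
     than [eps]; the 1 avoids a zero denominator. *)
  exists (Rmin ((1 - Cmod z) / 2) (eps / (K / rho ^ 2 + 1))).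
  assert (HK1 : 0 <= K / rho ^ 2) by (apply Rdiv_le_0_compat; lra).
  assert (He1 : 0 < eps / (K / rho ^ 2 + 1)) by (apply Rdiv_lt_0_compat; lra).
  split; [apply Rmin_pos; lra|].
  intros w Hw. assert (Hw1 := Rlt_le_trans _ _ _ Hw (Rmin_l _ _)).
  assert (Hw2 := Rlt_le_trans _ _ _ Hw (Rmin_r _ _)).
  assert (Hwr : Cmod w <= rho).
  { replace w with ((w - z) + z)%C by ring. eapply Rle_trans; [apply Cmod_triangle|].
    unfold rho; lra. }
  assert (Hsz := proj1 (is_pseries_Cseries _ _ _) (Hf z Hz)).
  assert (Hwd : in_disk w) by (unfold in_disk; lra).
  assert (Hsw := proj1 (is_pseries_Cseries _ _ _) (Hf w Hwd)).
  assert (Hs : is_Cseries (fun k => b k * (w ^ k - z ^ k - RtoC (INR k) * z ^ (k - 1) * (w - z)))%C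
     (f w - f z - l * (w - z))%C).
  { generalize (is_Cseries_plus _ _ _ _ Hsw (is_Cseries_plus _ _ _ _
      (is_Cseries_scal (-(1))%C _ _ Hsz) (is_Cseries_scal (- (w - z))%C _ _ Hl))).
    replace (f w + (- (1) * f z + - (w - z) * l))%C with (f w - f z - l * (w - z))%C by ring.
    apply is_Cseries_ext. intros k. ring. }
  assert (Hb : Cmod (f w - f z - l * (w - z)) <= (Cmod (w - z) ^ 2 / rho ^ 2) * K).
  { eapply Cmod_Cseries_le; [exact Hs|
      apply (is_series_scal (K := R_AbsRing) (V := R_NormedModule)
              (Cmod (w - z) ^ 2 / rho ^ 2)); exact HK|].
    intros k. cbv beta. rewrite Cmod_mult.
    assert (Ht := Cpow_taylor_bound rho z w k ltac:(lra) ltac:(unfold rho; lra) Hwr).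
    match type of Ht with Cmod ?e * _ <= _ => set (E := e) in * end.
    change (Cmod (b k) * Cmod E <= Cmod (w - z) ^ 2 / rho ^ 2 * (Cmod (b k) * ((INR k + 1) ^ 2 * rho ^ k))).
    replace (Cmod (w - z) ^ 2 / rho ^ 2 * (Cmod (b k) * ((INR k + 1) ^ 2 * rho ^ k)))
      with (Cmod (b k) * ((INR k + 1) ^ 2 * rho ^ k * Cmod (w - z) ^ 2 / rho ^ 2)) by (field; lra).
    apply Rmult_le_compat_l; [apply Cmod_ge_0|].
    apply Rmult_le_reg_r with (rho ^ 2); [auto|].
    unfold Rdiv. rewrite (Rmult_assoc _ (/ rho ^ 2)), Rinv_l, Rmult_1_r by lra.
    eapply Rle_trans; [exact Ht|].
    apply Rmult_le_compat_r; [apply pow2_ge_0|].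
    apply Rmult_le_compat_r; [apply pow_le; lra|]. generalize (pos_INR k). nra. }
  eapply Rle_trans; [exact Hb|].
  replace (Cmod (w - z) ^ 2 / rho ^ 2 * K) with ((K / rho ^ 2 * Cmod (w - z)) * Cmod (w - z))
    by (field; lra).
  apply Rmult_le_compat_r; [apply Cmod_ge_0|].
  apply Rmult_lt_compat_r with (r := K / rho ^ 2 + 1) in Hw2; [|lra].
  unfold Rdiv at 2 in Hw2. rewrite Rmult_assoc, Rinv_l, Rmult_1_r in Hw2 by lra.
  generalize (Cmod_ge_0 (w - z)). nra.
Qed.

Lemma has_expansion_derivative (f : C -> C) (b : nat -> C) :
  has_expansion f b ->
  (forall z, in_disk z -> is_Cderive f z (C_derive f z)) /\
  has_expansion (C_derive f) (fun k => RtoC (INR (S k)) * b (S k))%C.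
Proof.
  intros Hf. split; intros z Hz; destruct (Cseries_derivative f b z Hf Hz) as [l [Hl Hs]];
    rewrite (is_C_derive_unique f z l Hl); [exact Hl|].
  apply is_pseries_Cseries; exact Hs.
Qed.

Lemma has_expansion_analytic (f : C -> C) (b : nat -> C) :
  has_expansion f b -> analytic_on_disk f.
Proof.
  intros Hf z Hz. exists (C_derive f z). apply (has_expansion_derivative f b Hf); exact Hz.
Qed.

(** * Maxima over a closed disk *)

Lemma Cmod_le_Re_Im (z : C) : Cmod z <= Rabs (Re z) + Rabs (Im z).
Proof.
  apply Rsqr_incr_0; [|apply Cmod_ge_0|generalize (Rabs_pos (Re z)) (Rabs_pos (Im z)); lra].
  rewrite !Rsqr_pow2, Cmod2_alt, <- (pow2_abs (Re z)), <- (pow2_abs (Im z)).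
  generalize (Rabs_pos (Re z)) (Rabs_pos (Im z)); nra.
Qed.

Lemma im_le_Cmod (z : C) : Rabs (Im z) <= Cmod z.
Proof.
  apply Rsqr_incr_0; [|apply Rabs_pos|apply Cmod_ge_0].
  rewrite !Rsqr_pow2, Cmod2_alt, pow2_abs. generalize (pow2_ge_0 (Re z)); lra.
Qed.

(** Heine-Borel as a passage from local to uniform: [Q d w] weakens as [d] shrinks, so the least of
    finitely many local [d] works everywhere. The disk is placed in a square and covered by open
    squares. The covering theorem gives only a doubly negated witness, hence the argument by
    contradiction. *)
Lemma closed_disk_compact (rad : R) (Q : R -> C -> Prop) :
  (forall d d' w, d <= d' -> Q d' w -> Q d w) ->
  (forall z, Cmod z <= rad -> exists d, 0 < d /\
     forall w, Cmod w <= rad -> Cmod (w - z) < d -> Q d w) ->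
  exists d, 0 < d /\ forall w, Cmod w <= rad -> Q d w.
Proof.
  intros Hmono Hloc.
  assert (Hch : forall u v : R, exists e : posreal, forall w, Cmod w <= rad ->
    Rabs (Re w - u) < e -> Rabs (Im w - v) < e -> Q e w).
  { intros u v. destruct (Rle_or_lt (Cmod (u, v)) rad) as [H|H].
    (* Half of [d], since the modulus is bounded by the sum of the two coordinate distances. *)
    - destruct (Hloc (u, v) H) as [d [Hd Hd']].
      assert (Hd2 : 0 < d / 2) by lra. exists (mkposreal _ Hd2). simpl.
      intros w Hw H1 H2. apply Hmono with d; [lra|]. apply Hd'; [exact Hw|].
      eapply Rle_lt_trans; [apply Cmod_le_Re_Im|]. destruct w as [x y]; simpl in *.
      unfold Rminus in *. lra.
    (* A centre outside the disk gets a square that misses the disk, so its condition is vacuous. *)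
    - assert (Hd : 0 < (Cmod (u, v) - rad) / 2) by lra. exists (mkposreal _ Hd). simpl.
      intros w Hw H1 H2. exfalso.
      assert (Hc : Cmod (u, v) <= Cmod w + Cmod (w - (u, v))).
      { replace (u, v) with (w + - (w - (u, v)))%C at 1 by ring.
        eapply Rle_trans; [apply Cmod_triangle|]. rewrite Cmod_opp. lra. }
      generalize (Cmod_le_Re_Im (w - (u, v))%C). destruct w as [x y]; simpl in *.
      unfold Rminus in *. lra. }
  destruct (choice (fun (uv : R * R) (e : posreal) => forall w, Cmod w <= rad ->
    Rabs (Re w - fst uv) < e -> Rabs (Im w - snd uv) < e -> Q e w)) as [e He].
  { intros [u v]; apply Hch. }
  destruct (compactness_value_2d (- rad) rad (- rad) rad (fun u v => e (u, v))) as [d Hd].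
  exists d; split; [apply cond_pos|]. intros w Hw. apply NNPP. intros HQ.
  apply (Hd (Re w) (Im w)).
  - generalize (re_le_Cmod w). intros HH. apply Rabs_le_between. lra.
  - generalize (im_le_Cmod w). intros HH. apply Rabs_le_between. lra.
  - intros (u & v & _ & _ & H1 & H2 & H3). apply HQ.
    apply Hmono with (e (u, v)); [exact H3|]. apply He; auto.
Qed.

(** Compactness is used twice: with [F w <= / d] for boundedness, and, if the supremum [M] were not
    attained, with [F w <= M - d], which contradicts its minimality. *)
Lemma closed_disk_max (rad : R) (F : C -> R) :
  0 <= rad ->
  (forall z, Cmod z <= rad -> forall eps, 0 < eps -> exists d, 0 < d /\
     forall w, Cmod w <= rad -> Cmod (w - z) < d -> Rabs (F w - F z) < eps) ->
  exists z0, Cmod z0 <= rad /\ forall z, Cmod z <= rad -> F z <= F z0.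
Proof.
  intros Hrad Hc.
  assert (Hbd : exists d, 0 < d /\ forall w, Cmod w <= rad -> F w <= / d).
  { destruct (closed_disk_compact rad (fun d w => 0 < d -> F w <= / d)) as [d [Hd Hd']].
    - intros d d' w Hdd H Hd. eapply Rle_trans; [apply H; lra|]. apply Rinv_le_contravar; lra.
    - intros z Hz. destruct (Hc z Hz 1 Rlt_0_1) as [d [Hd Hd']].
      assert (Hp : 0 < / (Rabs (F z) + 1)) by (apply Rinv_0_lt_compat; generalize (Rabs_pos (F z)); lra).
      exists (Rmin d (/ (Rabs (F z) + 1))). split; [apply Rmin_pos; auto|].
      intros w Hw Hwz Hm.
      apply Rle_trans with (/ / (Rabs (F z) + 1)).
      + rewrite Rinv_inv.
        specialize (Hd' w Hw (Rlt_le_trans _ _ _ Hwz (Rmin_l _ _))).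
        apply Rabs_lt_between in Hd'. generalize (Rle_abs (F z)). lra.
      + apply Rinv_le_contravar; [auto|apply Rmin_r].
    - exists d; split; auto. }
  destruct Hbd as [d0 [Hd0 Hbd]].
  destruct (completeness (fun x => exists z, Cmod z <= rad /\ x = F z)) as [M [HM1 HM2]].
  { exists (/ d0). intros x [z [Hz ->]]. auto. }
  { exists (F 0%C), 0%C. split; [rewrite Cmod_0; lra|reflexivity]. }
  assert (HF : forall z, Cmod z <= rad -> F z <= M) by (intros z Hz; apply HM1; exists z; auto).
  apply NNPP. intros Hno.
  assert (HF' : forall z, Cmod z <= rad -> F z < M).
  { intros z Hz. destruct (Rle_lt_or_eq_dec _ _ (HF z Hz)) as [H|H]; [exact H|].
    exfalso. apply Hno. exists z. split; [exact Hz|]. intros w Hw. rewrite H; auto. }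
  destruct (closed_disk_compact rad (fun d w => F w <= M - d)) as [d [Hd Hd']].
  - intros d d' w Hdd H. lra.
  - intros z Hz. assert (Hlt := HF' z Hz).
    destruct (Hc z Hz ((M - F z) / 2) ltac:(lra)) as [d [Hd Hd']].
    exists (Rmin d ((M - F z) / 2)). split; [apply Rmin_pos; lra|].
    intros w Hw Hwz.
    specialize (Hd' w Hw (Rlt_le_trans _ _ _ Hwz (Rmin_l _ _))).
    apply Rabs_lt_between in Hd'. generalize (Rmin_r d ((M - F z) / 2)). lra.
  - assert (M <= M - d); [|lra].
    apply HM2. intros x [z [Hz ->]]. auto.
Qed.

(** * Second derivatives along lines *)

(** There is no need to know that [dphi 0] vanishes: if [l > 0], a small move to the right when
    [dphi 0 >= 0], or to the left otherwise, would increase [phi]. *)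
Lemma second_derivative_at_max (phi dphi : R -> R) (l delta : R) :
  0 < delta ->
  (forall t, Rabs t < delta -> is_derive phi t (dphi t)) ->
  (forall t, Rabs t < delta -> phi t <= phi 0) ->
  is_derive dphi 0 l -> l <= 0.
Proof.
  intros Hdelta Hphi Hmax Hl. apply Rnot_lt_le. intros Hpos.
  apply is_derive_Reals in Hl.
  destruct (Hl (l / 2) ltac:(lra)) as [e He].
  set (t0 := Rmin delta e / 2).
  assert (Hm : 0 < Rmin delta e) by (apply Rmin_pos; [lra|apply cond_pos]).
  assert (Ht1 : 0 < t0 < delta) by (generalize (Rmin_l delta e); unfold t0; lra).
  assert (Ht2 : t0 < e) by (generalize (Rmin_r delta e); unfold t0; lra).
  assert (Hinc : forall t, t <> 0 -> Rabs t <= t0 ->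
     Rabs ((dphi t - dphi 0) / t - l) < l / 2).
  { intros t Ht Htt. specialize (He t Ht ltac:(lra)). rewrite Rplus_0_l in He. exact He. }
  assert (Hder : forall t, Rabs t <= t0 -> derivable_pt_lim phi t (dphi t)).
  { intros t Ht. apply is_derive_Reals, Hphi. lra. }
  destruct (Rle_or_lt 0 (dphi 0)) as [H0|H0].
  - destruct (MVT_cor2 phi dphi 0 t0) as [c [Hc1 Hc2]]; [lra| |].
    { intros x Hx. apply Hder. apply Rabs_le_between; lra. }
    assert (Hle : phi t0 <= phi 0) by (apply Hmax; apply Rabs_lt_between; lra).
    assert (Hc : dphi c <= 0) by nra.
    assert (H := Hinc c ltac:(lra) ltac:(rewrite Rabs_pos_eq; lra)).
    apply Rabs_lt_between in H.
    assert (dphi c - dphi 0 = (dphi c - dphi 0) / c * c) by (field; lra). nra.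
  - destruct (MVT_cor2 phi dphi (- t0) 0) as [c [Hc1 Hc2]]; [lra| |].
    { intros x Hx. apply Hder. apply Rabs_le_between; lra. }
    assert (Hle : phi (- t0) <= phi 0) by (apply Hmax; apply Rabs_lt_between; lra).
    assert (Hc : 0 <= dphi c) by nra.
    assert (H := Hinc c ltac:(lra) ltac:(rewrite Rabs_left; lra)).
    apply Rabs_lt_between in H.
    assert (dphi c - dphi 0 = (dphi c - dphi 0) / c * c) by (field; lra). nra.
Qed.

Lemma Cmod_sqr_line (z d : C) (t : R) :
  Cmod (z + RtoC t * d) ^ 2 = Cmod z ^ 2 + 2 * t * Re (Cconj z * d)%C + t ^ 2 * Cmod d ^ 2.
Proof.
  rewrite !Cmod2_alt. destruct z as [x y], d as [u v]. simpl. ring.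
Qed.

(** ln |q| is locally the real part of log q, whose derivative is q' / q. Writing it as half of ln
    (A^2 + B^2) avoids a choice of branch. *)
Lemma is_derive_ln_Cmod_line (q : C -> C) (z d l : C) (t : R) :
  is_Cderive q (z + RtoC t * d)%C l -> q (z + RtoC t * d)%C <> 0%C ->
  is_derive (fun s => ln (Cmod (q (z + RtoC s * d)%C))) t
    (Re (d * (l / q (z + RtoC t * d)))%C).
Proof.
  intros Hl Hq. set (w := q (z + RtoC t * d)%C) in *.
  assert (Hre := is_Cderive_line q z d l t Hl).
  (* The real part of -i q is the imaginary part of q. *)
  assert (Him := is_Cderive_line _ z d _ t (is_Cderive_scal (- Ci)%C q _ l Hl)).
  set (A := fun s => Re (q (z + RtoC s * d)%C)) in *.
  set (B := fun s : R => Re (- Ci * q (z + RtoC s * d))%C) in *.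
  assert (HB : forall s, B s = Im (q (z + RtoC s * d)%C))
    by (intros s; unfold B; destruct (q (z + RtoC s * d)%C); simpl; ring).
  assert (HAB : forall s, Cmod (q (z + RtoC s * d)%C) ^ 2 = A s ^ 2 + B s ^ 2)
    by (intros s; rewrite Cmod2_alt, HB; reflexivity).
  assert (Hpos : 0 < A t ^ 2 + B t ^ 2).
  { rewrite <- HAB. apply pow_lt, Cmod_gt_0; exact Hq. }
  assert (Hln : forall s, / 2 * ln (A s ^ 2 + B s ^ 2) = ln (Cmod (q (z + RtoC s * d)%C))).
  { intros s. rewrite <- HAB. destruct (Rle_lt_or_eq_dec _ _ (Cmod_ge_0 (q (z + RtoC s * d)%C))) as [H|H].
    - simpl. rewrite Rmult_1_r, ln_mult by auto. lra.
    (* At a zero of q both sides vanish because [ln 0] is 0 by convention; thus the identity holds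
       for every [s]. *)
    - rewrite <- H. replace (0 ^ 2) with 0 by ring.
      unfold ln. destruct (Rlt_dec 0 0); [exfalso|]; lra. }
  apply is_derive_ext with (1 := Hln).
  assert (HA : A t = Re w) by reflexivity. assert (HBt := HB t). fold w in HBt.
  clear Hln HAB HB. clearbody A B.
  auto_derive.
  { repeat split; [eexists; exact Hre|eexists; exact Him|]. simpl in *. lra. }
  replace (Derive (fun x : R => A x) t) with (Re (l * d)%C)
    by (symmetry; apply is_derive_unique; exact Hre).
  replace (Derive (fun x : R => B x) t) with (Re (- Ci * l * d)%C)
    by (symmetry; apply is_derive_unique; exact Him).
  assert (Hw : w <> 0%C) by exact Hq.
  rewrite HA, HBt in *. clear - Hpos.
  destruct w as [x y], d as [u v], l as [a b]. simpl in *.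
  field. nra.
Qed.

(** * The Schwarz-Pick estimate *)

(** Logarithm of the weight in [pick_functional], as a function of s = |z|^2 with [rho] standing for
    rad^(2(m+1)); the variable s is polynomial in the coordinates, so nothing is singular at z = 0.
    [log_weight1] and [log_weight2] are its first two derivatives. *)
Definition log_weight (m : nat) (rho eps s : R) : R := ln (rho - s ^ S m) + ln (1 + eps * s).

Definition log_weight1 (m : nat) (rho eps s : R) : R :=
  - (INR (S m) * s ^ m) / (rho - s ^ S m) + eps / (1 + eps * s).

Definition log_weight2 (m : nat) (rho eps s : R) : R :=
  - INR (S m) * (INR m * s ^ (m - 1) * (rho - s ^ S m) + s ^ m * (INR (S m) * s ^ m))
    / (rho - s ^ S m) ^ 2 - eps ^ 2 / (1 + eps * s) ^ 2.

Lemma is_derive_log_weight (m : nat) (rho eps s : R) :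
  s ^ S m < rho -> 0 < 1 + eps * s ->
  is_derive (log_weight m rho eps) s (log_weight1 m rho eps s).
Proof.
  intros H1 H2. unfold log_weight, log_weight1.
  evar_last.
  - apply (is_derive_plus (K := R_AbsRing) (V := R_NormedModule) (fun s => ln (rho - s ^ S m)) (fun s => ln (1 + eps * s))).
    + apply (is_derive_comp (K := R_AbsRing) (V := R_NormedModule) ln (fun s => rho - s ^ S m)).
      * apply is_derive_ln. lra.
      * apply (is_derive_minus (K := R_AbsRing) (V := R_NormedModule) (fun _ => rho) (fun s => s ^ S m)).
        { apply (is_derive_const (K := R_AbsRing) (V := R_NormedModule)). }
        apply is_derive_pow. apply (is_derive_id (K := R_AbsRing)).
    + auto_derive; [exact H2|reflexivity].
  - simpl pred. change (scal (V := R_NormedModule) ?a ?b) with (a * b).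
    change ((0 + - (INR (S m) * 1 * s ^ m)) * / (rho - s ^ S m) + eps * 1 * / (1 + eps * s)
      = - (INR (S m) * s ^ m) / (rho - s ^ S m) + eps / (1 + eps * s)).
    field. lra.
Qed.

Lemma is_derive_log_weight1 (m : nat) (rho eps s : R) :
  s ^ S m < rho -> 0 < 1 + eps * s ->
  is_derive (log_weight1 m rho eps) s (log_weight2 m rho eps s).
Proof.
  intros H1 H2. unfold log_weight1, log_weight2.
  evar_last.
  - apply (is_derive_plus (K := R_AbsRing) (V := R_NormedModule)
      (fun s => - (INR (S m) * s ^ m) / (rho - s ^ S m)) (fun s => eps / (1 + eps * s))).
    + apply (is_derive_div (fun s => - (INR (S m) * s ^ m)) (fun s => rho - s ^ S m)).
      * apply (is_derive_opp (K := R_AbsRing) (V := R_NormedModule) (fun s => INR (S m) * s ^ m)).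
        apply (is_derive_scal (fun s => s ^ m)). apply is_derive_pow. apply (is_derive_id (K := R_AbsRing)).
      * apply (is_derive_minus (K := R_AbsRing) (V := R_NormedModule) (fun _ => rho) (fun s => s ^ S m)).
        { apply (is_derive_const (K := R_AbsRing) (V := R_NormedModule)). }
        apply is_derive_pow. apply (is_derive_id (K := R_AbsRing)).
      * lra.
    + auto_derive; [lra|reflexivity].
  - simpl pred. replace (pred m) with (m - 1)%nat by lia.
    change ((- (INR (S m) * (INR m * 1 * s ^ (m - 1))) * (rho - s ^ S m)
        - (- (INR (S m) * s ^ m)) * (0 + - (INR (S m) * 1 * s ^ m))) / (rho - s ^ S m) ^ 2
       + eps * (- (eps * 1) * / ((1 + eps * s) * (1 + eps * s)))
      = - INR (S m) * (INR m * s ^ (m - 1) * (rho - s ^ S m) + s ^ m * (INR (S m) * s ^ m))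
    / (rho - s ^ S m) ^ 2 - eps ^ 2 / (1 + eps * s) ^ 2).
    field. lra.
Qed.

(** For a radial function L(|z|^2) the Laplacian is 4 (s L'' + L'). The first term on the right is
    the curvature equation of the hyperbolic metric pulled back along z^(m+1); the second, coming
    from the [eps] factor, is positive. *)
Lemma log_weight_laplacian (m : nat) (rho eps s : R) :
  s ^ S m < rho -> 0 < 1 + eps * s ->
  s * log_weight2 m rho eps s + log_weight1 m rho eps s =
  - (INR (S m) ^ 2 * s ^ m * rho) / (rho - s ^ S m) ^ 2 + eps / (1 + eps * s) ^ 2.
Proof.
  intros H1 H2. unfold log_weight1, log_weight2.
  (* The exponent [m - 1] truncates at [m = 0], where its coefficient [INR m] is 0. *)
  destruct m as [|m].
  - simpl in *. field. lra.
  - replace (S m - 1)%nat with m by lia. rewrite (S_INR (S m)).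
    change (s ^ S (S m)) with (s * (s * s ^ m)) in *. change (s ^ S m) with (s * s ^ m) in *.
    field. lra.
Qed.

Lemma is_derive_ln_Re_line (p : C -> C) (z d l : C) (t : R) :
  is_Cderive p (z + RtoC t * d)%C l -> 0 < Re (p (z + RtoC t * d)%C) ->
  is_derive (fun s => ln (Re (p (z + RtoC s * d)%C))) t
    (Re (l * d)%C / Re (p (z + RtoC t * d)%C)).
Proof.
  intros Hl Hp. evar_last.
  - apply (is_derive_comp (K := R_AbsRing) (V := R_NormedModule) ln
      (fun s => Re (p (z + RtoC s * d)%C))).
    + apply is_derive_ln; exact Hp.
    + apply is_Cderive_line; exact Hl.
  - reflexivity.
Qed.

Lemma pow_S_lt (x y : R) (n : nat) : 0 <= x < y -> x ^ S n < y ^ S n.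
Proof.
  intros H. induction n as [|n IH]; [simpl; lra|].
  change (x * x ^ S n < y * y ^ S n).
  apply Rmult_le_0_lt_compat; try lra. apply pow_le; lra.
Qed.

Lemma Cmod_open (rad : R) (z0 : C) :
  Cmod z0 < rad -> forall w, Cmod (w - z0) < rad - Cmod z0 -> Cmod w < rad.
Proof.
  intros H w Hw. replace w with ((w - z0) + z0)%C by ring.
  eapply Rle_lt_trans; [apply Cmod_triangle|]. lra.
Qed.

(* Quotient of the metric [|p'| / Re p] by the hyperbolic metric pulled back along [z^(m+1)].
   The factor [1 + eps |z|^2] makes the Laplacian inequality strict at [z = 0], where both
   metrics degenerate. *)
Definition pick_functional (m : nat) (rad eps : R) (p q : C -> C) (z : C) : R :=
  Cmod (q z) * ((rad ^ (2 * S m) - (Cmod z ^ 2) ^ S m) * (1 + eps * Cmod z ^ 2)) / Re (p z).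

(** The left side is the second derivative at t = 0 of the logarithm of the functional at z0 + t d.
    Since |d| = 1, the squared modulus along the line is s + 2 k t + t^2. The directions 1 and i
    together will give the Laplacian. *)
Lemma directional_second_derivative (p q : C -> C) (b c : nat -> C) (m : nat) (rad eps : R)
  (z0 d : C) :
  has_expansion p c -> has_expansion q b ->
  (forall z, in_disk z -> 0 < Re (p z)) ->
  0 < rad < 1 -> 0 < eps -> Cmod z0 < rad -> q z0 <> 0%C -> Cmod d = 1 ->
  (forall z, Cmod z <= rad ->
    pick_functional m rad eps p q z <= pick_functional m rad eps p q z0) ->
  let s := Cmod z0 ^ 2 in let rho := rad ^ (2 * S m) in
  let k := Re (Cconj z0 * d)%C in
  let p1 := C_derive p z0 in let p2 := C_derive (C_derive p) z0 in
  let q1 := C_derive q z0 in let q2 := C_derive (C_derive q) z0 in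
  Re (d * d * ((q2 * q z0 - q1 * q1) / (q z0 * q z0)))%C
  + (log_weight2 m rho eps s * (2 * k) ^ 2 + 2 * log_weight1 m rho eps s)
  - (Re (p2 * d * d)%C * Re (p z0) - Re (p1 * d)%C ^ 2) / Re (p z0) ^ 2 <= 0.
Proof.
  intros Hp Hq Hpos Hrad Heps Hz0 Hqz Hd Hmax s rho k p1 p2 q1 q2.
  destruct (has_expansion_derivative p c Hp) as [Dp Hp1].
  destruct (has_expansion_derivative _ _ Hp1) as [Dp1 _].
  destruct (has_expansion_derivative q b Hq) as [Dq Hq1].
  destruct (has_expansion_derivative _ _ Hq1) as [Dq1 _].
  assert (Hz0d : in_disk z0) by (unfold in_disk; lra).
  (* Stay where q differs from q(z0) by less than |q(z0)|, so that its logarithm remains defined. *)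
  destruct (is_Cderive_continuous q z0 _ (Dq z0 Hz0d) (Cmod (q z0))) as [e [He Hqe]];
    [apply Cmod_gt_0; exact Hqz|].
  set (delta := Rmin e (rad - Cmod z0)).
  assert (Hdelta : 0 < delta) by (apply Rmin_pos; lra).
  set (zt := fun t : R => (z0 + RtoC t * d)%C).
  assert (Hzt : forall t, Cmod (zt t - z0) = Rabs t).
  { intros t. unfold zt. replace (z0 + RtoC t * d - z0)%C with (RtoC t * d)%C by ring.
    rewrite Cmod_mult, Hd, Cmod_R. ring. }
  assert (Hin : forall t, Rabs t < delta -> Cmod (zt t) < rad).
  { intros t Ht. apply (Cmod_open rad z0 Hz0). rewrite Hzt.
    eapply Rlt_le_trans; [exact Ht|apply Rmin_r]. }
  assert (Hqt : forall t, Rabs t < delta -> q (zt t) <> 0%C).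
  { intros t Ht H0. assert (Hlt := Hqe (zt t)). rewrite Hzt, H0 in Hlt.
    specialize (Hlt (Rlt_le_trans _ _ _ Ht (Rmin_l _ _))).
    replace (0 - q z0)%C with (- q z0)%C in Hlt by ring. rewrite Cmod_opp in Hlt. lra. }
  assert (Hs : forall t, Cmod (zt t) ^ 2 = s + 2 * k * t + t ^ 2).
  { intros t. unfold zt. rewrite Cmod_sqr_line, Hd. unfold s, k. ring. }
  assert (Hw : forall z, Cmod z < rad -> (Cmod z ^ 2) ^ S m < rho /\ 0 < 1 + eps * Cmod z ^ 2).
  { intros z Hz. generalize (Cmod_ge_0 z) (pow2_ge_0 (Cmod z)); intros Hc Hc2. split.
    - unfold rho. rewrite pow_mult. apply pow_S_lt. split; [exact Hc2|].
      apply (pow_S_lt _ _ 1). lra.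
    - nra. }
  set (phi := fun t => ln (Cmod (q (zt t))) + log_weight m rho eps (s + 2 * k * t + t ^ 2)
                       - ln (Re (p (zt t)))).
  set (dphi := fun t => Re (d * (C_derive q (zt t) / q (zt t)))%C
     + log_weight1 m rho eps (s + 2 * k * t + t ^ 2) * (2 * k + 2 * t)
     - Re (C_derive p (zt t) * d)%C / Re (p (zt t))).
  assert (Hexp : forall t, Rabs t < delta ->
     0 < pick_functional m rad eps p q (zt t) /\
     ln (pick_functional m rad eps p q (zt t)) = phi t).
  { intros t Ht. assert (Hi := Hin t Ht). destruct (Hw _ Hi) as [W1 W2].
    assert (P1 : 0 < Re (p (zt t))) by (apply Hpos; unfold in_disk; lra).
    assert (P2 : 0 < Cmod (q (zt t))) by (apply Cmod_gt_0, Hqt, Ht).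
    unfold pick_functional, phi, log_weight. fold rho. rewrite <- Hs.
    assert (P3 : 0 < rho - (Cmod (zt t) ^ 2) ^ S m) by lra.
    assert (P4 := Rmult_lt_0_compat _ _ P3 W2).
    assert (P5 := Rmult_lt_0_compat _ _ P2 P4).
    split; [apply Rdiv_lt_0_compat; [exact P5|exact P1]|].
    unfold Rdiv. rewrite (ln_mult _ _ P5 (Rinv_0_lt_compat _ P1)), (ln_mult _ _ P2 P4),
      (ln_mult _ _ P3 W2), (ln_Rinv _ P1). ring. }
  assert (Ds : forall t, is_derive (fun t => s + 2 * k * t + t ^ 2) t (2 * k + 2 * t)).
  { intros t. auto_derive; [auto|ring]. }
  assert (Hzero : Rabs 0 < delta) by (rewrite Rabs_R0; lra).
  assert (Hzt0 : zt 0 = z0) by (unfold zt; ring).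
  apply (second_derivative_at_max phi dphi _ delta Hdelta).
  - intros t Ht. assert (Hi := Hin t Ht). destruct (Hw _ Hi) as [W1 W2].
    rewrite Hs in W1, W2.
    assert (Hzd : in_disk (zt t)) by (unfold in_disk; lra).
    unfold phi, dphi.
    apply (is_derive_minus (K := R_AbsRing) (V := R_NormedModule)
      (fun t => ln (Cmod (q (zt t))) + log_weight m rho eps (s + 2 * k * t + t ^ 2))
      (fun t => ln (Re (p (zt t))))).
    + apply (is_derive_plus (K := R_AbsRing) (V := R_NormedModule)
        (fun t => ln (Cmod (q (zt t)))) (fun t => log_weight m rho eps (s + 2 * k * t + t ^ 2))).
      * apply is_derive_ln_Cmod_line; [apply Dq; exact Hzd|apply Hqt; exact Ht].
      * rewrite (Rmult_comm (log_weight1 _ _ _ _)).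
        apply (is_derive_comp (K := R_AbsRing) (V := R_NormedModule) (log_weight m rho eps)
          (fun t => s + 2 * k * t + t ^ 2)); [apply is_derive_log_weight; auto|apply Ds].
    + apply is_derive_ln_Re_line; [apply Dp; exact Hzd|apply Hpos; exact Hzd].
  - intros t Ht. destruct (Hexp t Ht) as [E1 E2]. destruct (Hexp 0 Hzero) as [E3 E4].
    rewrite <- E2, <- E4, Hzt0 in *.
    apply ln_le; [exact E1|]. apply Hmax. generalize (Hin t Ht). lra.
  - destruct (Hw _ Hz0) as [W1 W2]. fold s in W1, W2.
    assert (Hs0 : s + 2 * k * 0 + 0 ^ 2 = s) by ring.
    unfold dphi. evar_last.
    + apply (is_derive_minus (K := R_AbsRing) (V := R_NormedModule)
        (fun t => Re (d * (C_derive q (zt t) / q (zt t)))%C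
           + log_weight1 m rho eps (s + 2 * k * t + t ^ 2) * (2 * k + 2 * t))
        (fun t => Re (C_derive p (zt t) * d)%C / Re (p (zt t)))).
      * apply (is_derive_plus (K := R_AbsRing) (V := R_NormedModule)
          (fun t => Re (d * (C_derive q (zt t) / q (zt t)))%C)
          (fun t => log_weight1 m rho eps (s + 2 * k * t + t ^ 2) * (2 * k + 2 * t))).
        { apply (is_Cderive_line (fun z => d * (C_derive q z / q z))%C).
          apply is_Cderive_scal. fold (zt 0). rewrite Hzt0.
          apply is_Cderive_div; [exact Hqz|apply Dq1; exact Hz0d|apply Dq; exact Hz0d]. }
        { apply (is_derive_mult (K := R_AbsRing)
            (fun t => log_weight1 m rho eps (s + 2 * k * t + t ^ 2)) (fun t => 2 * k + 2 * t)).
          - apply (is_derive_comp (K := R_AbsRing) (V := R_NormedModule) (log_weight1 m rho eps)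
              (fun t => s + 2 * k * t + t ^ 2)); [|apply Ds].
            rewrite Hs0. apply is_derive_log_weight1; auto.
          - apply (is_derive_plus (K := R_AbsRing) (V := R_NormedModule) (fun _ => 2 * k) (fun t => 2 * t)).
            + apply (is_derive_const (K := R_AbsRing) (V := R_NormedModule)).
            + apply (is_derive_scal (fun t => t)). apply (is_derive_id (K := R_AbsRing)).
          - apply Rmult_comm. }
      * apply (is_derive_div (fun t => Re (C_derive p (zt t) * d)%C) (fun t => Re (p (zt t)))).
        { apply (is_Cderive_line (fun z => C_derive p z * d)%C).
          apply is_Cderive_mult; [|apply is_Cderive_const]. fold (zt 0). rewrite Hzt0.
          apply Dp1; exact Hz0d. }
        { apply (is_Cderive_line p). fold (zt 0). rewrite Hzt0. apply Dp; exact Hz0d. }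
        { rewrite Hzt0. generalize (Hpos z0 Hz0d). lra. }
    + fold (zt 0). rewrite Hzt0, Hs0. fold p1 p2 q1 q2.
      replace (d * ((q2 * q z0 - q1 * q1) / (q z0 * q z0)) * d)%C
        with (d * d * ((q2 * q z0 - q1 * q1) / (q z0 * q z0)))%C by ring.
      replace ((p2 * d + p1 * 0) * d)%C with (p2 * d * d)%C by ring.
      change (Re (d * d * ((q2 * q z0 - q1 * q1) / (q z0 * q z0)))%C
        + ((2 * k + 2 * 0) * log_weight2 m rho eps s * (2 * k + 2 * 0)
           + log_weight1 m rho eps s * (0 + 2 * 1))
        - (Re (p2 * d * d)%C * Re (p z0) - Re (p1 * d)%C * Re (p1 * d)%C) / Re (p z0) ^ 2
       = Re (d * d * ((q2 * q z0 - q1 * q1) / (q z0 * q z0)))%C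
        + (log_weight2 m rho eps s * (2 * k) ^ 2 + 2 * log_weight1 m rho eps s)
        - (Re (p2 * d * d)%C * Re (p z0) - Re (p1 * d)%C ^ 2) / Re (p z0) ^ 2).
      replace (Re (p1 * d)%C * Re (p1 * d)%C) with (Re (p1 * d)%C ^ 2) by ring. ring.
Qed.

(** Here ln |q| is harmonic, -ln (Re p) has Laplacian |p'|^2 / (Re p)^2, and |p'|^2 = s^m |q|^2. The
    weight contributes a multiple of s^m as well, apart from its positive [eps] term. Cancelling s^m
    and taking square roots leaves the bound. *)
Lemma pick_functional_bound_at_max (p q : C -> C) (b c : nat -> C) (m : nat) (rad eps : R) (z0 : C) :
  has_expansion p c -> has_expansion q b ->
  (forall z, in_disk z -> 0 < Re (p z)) ->
  (forall z, in_disk z -> C_derive p z = (z ^ m * q z)%C) ->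
  0 < rad < 1 -> 0 < eps -> Cmod z0 < rad -> q z0 <> 0%C ->
  (forall z, Cmod z <= rad ->
    pick_functional m rad eps p q z <= pick_functional m rad eps p q z0) ->
  pick_functional m rad eps p q z0 <= 2 * INR (S m) * rad ^ S m * (1 + eps).
Proof.
  intros Hp Hq Hpos Hpq Hrad Heps Hz0 Hqz Hmax.
  assert (D1 := directional_second_derivative p q b c m rad eps z0 1%C Hp Hq Hpos Hrad Heps
     Hz0 Hqz Cmod_1 Hmax).
  assert (Di := directional_second_derivative p q b c m rad eps z0 Ci Hp Hq Hpos Hrad Heps
     Hz0 Hqz Cmod_Ci Hmax).
  cbv zeta in D1, Di.
  set (s := Cmod z0 ^ 2) in *. set (rho := rad ^ (2 * S m)) in *.
  assert (Hz0d : in_disk z0) by (unfold in_disk; lra).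
  assert (HP := Hpos z0 Hz0d). set (P := Re (p z0)) in *.
  assert (Hs0 : 0 <= s) by apply pow2_ge_0.
  assert (Hs1 : s <= 1) by (unfold s; generalize (Cmod_ge_0 z0); nra).
  assert (W1 : s ^ S m < rho).
  { unfold rho. rewrite pow_mult. apply pow_S_lt. split; [exact Hs0|].
    apply (pow_S_lt _ _ 1). generalize (Cmod_ge_0 z0); lra. }
  assert (W2 : 0 < 1 + eps * s) by nra.
  assert (Hlap := log_weight_laplacian m rho eps s W1 W2).
  set (L2 := log_weight2 m rho eps s) in *. set (L1 := log_weight1 m rho eps s) in *.
  set (g := ((C_derive (C_derive q) z0 * q z0 - C_derive q z0 * C_derive q z0) / (q z0 * q z0))%C) in *.
  set (p1 := C_derive p z0) in *. set (p2 := C_derive (C_derive p) z0) in *.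
  assert (HC : Cmod p1 ^ 2 = s ^ m * Cmod (q z0) ^ 2).
  { unfold p1. rewrite (Hpq z0 Hz0d), Cmod_mult, Cmod_pow, Rpow_mult_distr. unfold s.
    rewrite <- !pow_mult. f_equal. f_equal. lia. }
  rewrite Cmod2_alt in HC.
  assert (Hsum : 4 * (s * L2 + L1) + (Re p1 ^ 2 + Im p1 ^ 2) / P ^ 2 <= 0).
  (* Adding the directions 1 and i: terms containing d^2 cancel because 1 + i^2 = 0, the squares
     (2k)^2 add up to 4 s, and the squares of Re (p' d) to |p'|^2. *)
  { assert (Hs : s = Re z0 ^ 2 + Im z0 ^ 2) by apply Cmod2_alt.
    match type of D1 with ?X <= 0 => match type of Di with ?Y <= 0 =>
      apply Rle_trans with (X + Y); [right|lra] end end.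
    rewrite Hs. clear - HP. clearbody g p1 p2 P L1 L2.
    destruct z0 as [x y], g as [g1 g2], p1 as [a1 a2], p2 as [b1 b2]. simpl. field. lra. }
  rewrite HC, Hlap in Hsum.
  assert (HB : 0 < rho - s ^ S m) by lra. set (B := rho - s ^ S m) in *.
  set (Q := Cmod (q z0)) in *.
  assert (HQ : 0 < Q) by (apply Cmod_gt_0; exact Hqz).
  assert (Hsm : 0 <= s ^ m) by (apply pow_le; exact Hs0).
  assert (HE : 0 < eps / (1 + eps * s) ^ 2) by (apply Rdiv_lt_0_compat; [|apply pow_lt]; lra).
  assert (Hlt : s ^ m * (Q ^ 2 / P ^ 2) < s ^ m * (4 * INR (S m) ^ 2 * rho / B ^ 2)).
  { replace (s ^ m * (Q ^ 2 / P ^ 2)) with (s ^ m * Q ^ 2 / P ^ 2) by (field; lra).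
    replace (s ^ m * (4 * INR (S m) ^ 2 * rho / B ^ 2))
      with (- (4 * (- (INR (S m) ^ 2 * s ^ m * rho) / B ^ 2))) by (field; lra).
    lra. }
  assert (Hlt2 : Q ^ 2 / P ^ 2 < 4 * INR (S m) ^ 2 * rho / B ^ 2).
  (* If s^m were 0, the strict inequality would read 0 < 0; so s^m is positive and cancels. *)
  { apply Rmult_lt_reg_l with (s ^ m); [|exact Hlt].
    destruct Hsm as [H|H]; [exact H|]. rewrite <- H, !Rmult_0_l in Hlt. exfalso; lra. }
  assert (Hrm : 0 < rad ^ S m) by (apply pow_lt; lra).
  assert (Hn : 0 < INR (S m)) by (apply lt_0_INR; lia).
  assert (Hmain : Q * B / P <= 2 * INR (S m) * rad ^ S m).
  { apply Rsqr_incr_0; [|apply Rlt_le, Rdiv_lt_0_compat; [apply Rmult_lt_0_compat|]; lra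
      |apply Rlt_le, Rmult_lt_0_compat; [lra|exact Hrm]].
    rewrite !Rsqr_pow2.
    replace ((2 * INR (S m) * rad ^ S m) ^ 2) with (4 * INR (S m) ^ 2 * rho / B ^ 2 * B ^ 2).
    2:{ unfold rho. rewrite Nat.mul_comm, pow_mult. field. lra. }
    replace ((Q * B / P) ^ 2) with (Q ^ 2 / P ^ 2 * B ^ 2) by (field; lra).
    apply Rmult_le_compat_r; [apply pow2_ge_0|lra]. }
  unfold pick_functional. fold s rho Q P B.
  replace (Q * (B * (1 + eps * s)) / P) with ((Q * B / P) * (1 + eps * s)) by (field; lra).
  apply Rmult_le_compat; [|lra|exact Hmain|nra].
  apply Rlt_le, Rdiv_lt_0_compat; [apply Rmult_lt_0_compat|]; lra.
Qed.

(** * Dividing out zeros at the origin *)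

Lemma has_expansion_divide_one (f : C -> C) (b : nat -> C) :
  has_expansion f b -> b 0%nat = 0%C ->
  exists q, has_expansion q (fun k => b (S k)) /\ forall z, in_disk z -> f z = (z * q z)%C.
Proof.
  intros Hf Hb.
  (* The removable value at 0 is the coefficient b_1, as the shifted expansion requires. *)
  set (q := fun z : C => if Ceq_dec z 0%C then b 1%nat else (f z / z)%C).
  exists q.
  assert (Hfq : forall z, in_disk z -> f z = (z * q z)%C).
  { intros z Hz. unfold q. destruct (Ceq_dec z 0%C) as [->|Hz0]; [|field; exact Hz0].
    rewrite Cmult_0_l. apply (is_Cseries_unique (fun k => b k * 0 ^ k)%C).
    - apply is_pseries_Cseries, Hf. exact Hz.
    - assert (H := proj1 (is_pseries_Cseries _ _ _) (Hf 0%C Hz)).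
      apply (is_Cseries_scal 0%C) in H. rewrite Cmult_0_l in H.
      revert H. apply is_Cseries_ext. intros [|k]; [rewrite Hb; simpl; ring|].
      rewrite Cpow_S. ring. }
  split; [|exact Hfq]. intros z Hz. apply is_pseries_Cseries.
  assert (H := proj1 (is_pseries_Cseries _ _ _) (Hf z Hz)).
  unfold q. destruct (Ceq_dec z 0%C) as [->|Hz0].
  - replace (b 1%nat) with (b 1%nat * 0 ^ 0 + 0)%C by (simpl; ring).
    apply (is_Cseries_shift (fun k => b (S k) * 0 ^ k)%C).
    apply (is_Cseries_scal 0%C) in H. rewrite Cmult_0_l in H.
    revert H. apply is_Cseries_ext. intros k. rewrite Cpow_S. ring.
  - replace (f z) with ((fun k => b k * z ^ k)%C 0%nat + f z)%C in H by (cbv beta; rewrite Hb; simpl; ring).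
    apply is_Cseries_shift, (is_Cseries_scal (/ z)%C) in H.
    replace (f z / z)%C with (/ z * f z)%C by (unfold Cdiv; ring).
    revert H. apply is_Cseries_ext. intros k. rewrite Cpow_S. field. exact Hz0.
Qed.

Lemma has_expansion_divide_pow (m : nat) (f : C -> C) (b : nat -> C) :
  has_expansion f b -> (forall k, (k < m)%nat -> b k = 0%C) ->
  exists q, has_expansion q (fun k => b (m + k)%nat) /\
    forall z, in_disk z -> f z = (z ^ m * q z)%C.
Proof.
  revert f b. induction m as [|m IH]; intros f b Hf Hb.
  - exists f. split; [exact Hf|]. intros z _. simpl. ring.
  - destruct (has_expansion_divide_one f b Hf (Hb 0%nat ltac:(lia))) as [g [Hg Hfg]].
    destruct (IH g (fun k => b (S k)) Hg) as [q [Hq Hgq]]; [intros k Hk; apply Hb; lia|].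
    exists q. split; [exact Hq|].
    intros z Hz. rewrite (Hfg z Hz), (Hgq z Hz), Cpow_S. ring.
Qed.

(** The filter form gives access to the general rules for products and compositions; the uniform
    structure is named so that balls are disks for [Cmod]. *)
Definition Ccontinuous_at (F : C -> R) (z : C) : Prop :=
  filterlim F (locally (T := AbsRing_UniformSpace C_AbsRing) z) (locally (F z)).

Lemma Ccontinuous_at_eps (F : C -> R) (z : C) :
  Ccontinuous_at F z -> forall eps, 0 < eps -> exists d, 0 < d /\
    forall w, Cmod (w - z) < d -> Rabs (F w - F z) < eps.
Proof.
  intros H eps He.
  destruct (proj1 (filterlim_locally F (F z)) H (mkposreal eps He)) as [d Hd].
  exists d. split; [apply cond_pos|]. intros w Hw. apply Hd. exact Hw.
Qed.

Lemma Ccontinuous_at_Cmod (f : C -> C) (z l : C) :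
  is_Cderive f z l -> Ccontinuous_at (fun w => Cmod (f w)) z.
Proof.
  intros H. apply filterlim_locally. intros eps.
  destruct (is_Cderive_continuous f z l H eps (cond_pos eps)) as [d [Hd Hd']].
  exists (mkposreal d Hd). intros w Hw.
  change (Rabs (Cmod (f w) - Cmod (f z)) < eps).
  eapply Rle_lt_trans; [|apply Hd'; exact Hw].
  apply Rabs_le_between'. split.
  - generalize (Cmod_triangle (f w) (- (f w - f z))). rewrite Cmod_opp.
    replace (f w + - (f w - f z))%C with (f z) by ring. lra.
  - generalize (Cmod_triangle (f z) (f w - f z)).
    replace (f z + (f w - f z))%C with (f w) by ring. lra.
Qed.

Lemma Ccontinuous_at_Re (f : C -> C) (z l : C) :
  is_Cderive f z l -> Ccontinuous_at (fun w => Re (f w)) z.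
Proof.
  intros H. apply filterlim_locally. intros eps.
  destruct (is_Cderive_continuous f z l H eps (cond_pos eps)) as [d [Hd Hd']].
  exists (mkposreal d Hd). intros w Hw.
  change (Rabs (Re (f w) - Re (f z)) < eps).
  eapply Rle_lt_trans; [|apply Hd'; exact Hw].
  replace (Re (f w) - Re (f z)) with (Re (f w - f z)%C)
    by (unfold Cminus; rewrite re_plus, re_opp; ring).
  apply re_le_Cmod.
Qed.

Lemma Ccontinuous_at_pick_functional (m : nat) (rad eps : R) (p q : C -> C) (z dp dq : C) :
  is_Cderive p z dp -> is_Cderive q z dq -> 0 < Re (p z) ->
  Ccontinuous_at (pick_functional m rad eps p q) z.
Proof.
  intros Hp Hq Hpos.
  assert (Hw : continuous (fun x => (rad ^ (2 * S m) - (x ^ 2) ^ S m) * (1 + eps * x ^ 2)) (Cmod z)).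
  { apply (ex_derive_continuous (K := R_AbsRing) (V := R_NormedModule)). auto_derive. auto. }
  assert (Hz : Ccontinuous_at Cmod z) by exact (Ccontinuous_at_Cmod (fun w => w) z 1%C (is_Cderive_id z)).
  assert (Hi : filterlim Rinv (locally (Re (p z))) (locally (/ Re (p z)))).
  { apply (ex_derive_continuous (K := R_AbsRing) (V := R_NormedModule)). auto_derive. lra. }
  unfold Ccontinuous_at, pick_functional, Rdiv.
  apply (continuous_mult (U := AbsRing_UniformSpace C_AbsRing) (K := R_AbsRing)).
  - apply (continuous_mult (U := AbsRing_UniformSpace C_AbsRing) (K := R_AbsRing)).
    + exact (Ccontinuous_at_Cmod q z dq Hq).
    + exact (filterlim_comp _ _ _ _ _ _ _ _ Hz Hw).
  - exact (filterlim_comp _ _ _ _ _ _ _ _ (Ccontinuous_at_Re p z dp Hp) Hi).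
Qed.

(** A maximum over the closed disk exists by compactness. On the circle the weight is 0, and where q
    vanishes so does the functional; in the remaining case the maximum is interior and the Laplacian
    argument applies. *)
Lemma pick_functional_bound (p q : C -> C) (b c : nat -> C) (m : nat) (rad eps : R) :
  has_expansion p c -> has_expansion q b ->
  (forall z, in_disk z -> 0 < Re (p z)) ->
  (forall z, in_disk z -> C_derive p z = (z ^ m * q z)%C) ->
  0 < rad < 1 -> 0 < eps ->
  forall z, Cmod z <= rad ->
    pick_functional m rad eps p q z <= 2 * INR (S m) * rad ^ S m * (1 + eps).
Proof.
  intros Hp Hq Hpos Hpq Hrad Heps.
  destruct (has_expansion_derivative p c Hp) as [Dp _].
  destruct (has_expansion_derivative q b Hq) as [Dq _].
  destruct (closed_disk_max rad (pick_functional m rad eps p q)) as [z0 [Hz0 Hmax]]; [lra| |].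
  { intros z Hz e He. assert (Hzd : in_disk z) by (unfold in_disk; lra).
    destruct (Ccontinuous_at_eps _ z (Ccontinuous_at_pick_functional m rad eps p q z _ _
      (Dp z Hzd) (Dq z Hzd) (Hpos z Hzd)) e He) as [d [Hd Hd']].
    exists d. split; auto. }
  intros z Hz. eapply Rle_trans; [apply Hmax; exact Hz|].
  assert (Hrhs : 0 <= 2 * INR (S m) * rad ^ S m * (1 + eps)).
  { generalize (pos_INR (S m)); intros.
    apply Rmult_le_pos; [|lra]. apply Rmult_le_pos; [lra|apply pow_le; lra]. }
  destruct (Ceq_dec (q z0) 0%C) as [Hq0|Hq0].
  { unfold pick_functional. rewrite Hq0, Cmod_0. unfold Rdiv. rewrite !Rmult_0_l. exact Hrhs. }
  destruct (Rle_lt_or_eq_dec _ _ Hz0) as [Hlt|Heq].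
  - apply (pick_functional_bound_at_max p q b c); auto.
  - unfold pick_functional. rewrite Heq, pow_mult. unfold Rdiv.
    rewrite Rminus_diag, Rmult_0_l, Rmult_0_r, Rmult_0_l. exact Hrhs.
Qed.

Lemma bernoulli_one_minus (x : R) (n : nat) : 0 <= x <= 1 -> 1 - INR n * x <= (1 - x) ^ n.
Proof.
  intros Hx. induction n as [|n IH]; [simpl; lra|]. rewrite S_INR. simpl.
  generalize (pos_INR n). nra.
Qed.

(** The limit x -> 0+ in the only form needed, with linear error terms. *)
Lemma le_of_linear_perturbation (a b c d x0 : R) :
  0 < x0 -> (forall x, 0 < x < x0 -> a - b * x <= c + d * x) -> a <= c.
Proof.
  intros Hx0 H. apply Rnot_lt_le. intros Hlt.
  set (k := Rabs b + Rabs d + 1).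
  assert (Hk : 0 < k) by (unfold k; generalize (Rabs_pos b) (Rabs_pos d); lra).
  assert (H1 : 0 < (a - c) / k) by (apply Rdiv_lt_0_compat; lra).
  set (x := Rmin x0 ((a - c) / k) / 2).
  assert (Hm : 0 < Rmin x0 ((a - c) / k)) by (apply Rmin_pos; auto).
  assert (Hx : 0 < x < x0) by (unfold x; generalize (Rmin_l x0 ((a - c) / k)); lra).
  assert (Hx2 : x < (a - c) / k) by (unfold x; generalize (Rmin_r x0 ((a - c) / k)); lra).
  specialize (H x Hx).
  apply Rmult_lt_compat_r with (r := k) in Hx2; [|exact Hk].
  replace ((a - c) / k * k) with (a - c) in Hx2 by (field; lra).
  unfold k in Hx2.
  assert (b * x <= Rabs b * x) by (apply Rmult_le_compat_r; [lra|apply Rle_abs]).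
  assert (d * x <= Rabs d * x) by (apply Rmult_le_compat_r; [lra|apply Rle_abs]).
  lra.
Qed.

(** With n = m + 1, the first m coefficients of p' vanish, so p' = z^m q. The functional is bounded
    with [rad = 1 - x] and [eps = x], and then x tends to 0. *)
Lemma class_P_log_derivative_bound (n : nat) (p : C -> C) (z : C) :
  (1 <= n)%nat -> class_P n p -> in_disk z ->
  Cmod (z * C_derive p z) * (1 - Cmod z ^ (2 * n)) <= 2 * INR n * Cmod z ^ n * Re (p z).
Proof.
  intros Hn [_ [[c [Hp [_ Hc]]] Hpos]] Hz.
  destruct n as [|m]; [lia|].
  destruct (has_expansion_derivative p c Hp) as [Dp Hp1].
  destruct (has_expansion_divide_pow m _ _ Hp1) as [q [Hq Hpq]].
  { intros k Hk. rewrite (Hc (S k)) by lia. ring. }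
  rewrite Cmod_mult, (Hpq z Hz), Cmod_mult, Cmod_pow.
  assert (HP := Hpos z Hz). assert (Hz0 := Cmod_ge_0 z). unfold in_disk in Hz.
  assert (Hqz := Cmod_ge_0 (q z)).
  set (r := Cmod z) in *. set (Q := Cmod (q z)) in *. set (P := Re (p z)) in *.
  set (N := INR (S m)). assert (HN : 0 <= N) by apply pos_INR.
  assert (Hmain : Q * (1 - r ^ (2 * S m)) <= 2 * N * P).
  (* The error on the left is Bernoulli's inequality for (1 - x)^(2n), the one on the right comes
     from the factor 1 + eps; x < 1 - |z| keeps z inside the disk of radius 1 - x. *)
  { apply le_of_linear_perturbation with (b := Q * INR (2 * S m)) (d := 2 * N * P) (x0 := 1 - r);
      [lra|].
    intros x Hx.
    assert (Hb := pick_functional_bound p q _ c m (1 - x) x Hp Hq Hpos Hpq ltac:(lra) ltac:(lra) z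
      ltac:(fold r; lra)).
    unfold pick_functional in Hb. fold r Q P N in Hb.
    apply Rmult_le_compat_r with (r := P) in Hb; [|lra].
    match type of Hb with ?X / P * P <= _ => replace (X / P * P) with X in Hb by (field; lra) end.
    assert (Hber := bernoulli_one_minus x (2 * S m) ltac:(lra)).
    assert (Hle1 : (1 - x) ^ S m <= 1) by (apply Rle_trans with (1 ^ S m); [apply pow_incr; lra|rewrite pow1; lra]).
    assert (HB0 : 0 <= (1 - x) ^ (2 * S m) - (r ^ 2) ^ S m).
    { rewrite <- pow_mult. assert (r ^ (2 * S m) <= (1 - x) ^ (2 * S m)); [|lra].
      apply pow_incr; lra. }
    rewrite <- pow_mult in Hb, HB0.
    set (B := (1 - x) ^ (2 * S m)) in *. set (s := r ^ (2 * S m)) in *.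
    apply Rle_trans with (Q * (B - s)).
    { replace (Q * (1 - s) - Q * INR (2 * S m) * x) with (Q * (1 - INR (2 * S m) * x - s)) by ring.
      apply Rmult_le_compat_l; lra. }
    apply Rle_trans with (Q * ((B - s) * (1 + x * r ^ 2))).
    { apply Rmult_le_compat_l; [lra|].
      assert (0 <= x * r ^ 2) by (apply Rmult_le_pos; [lra|apply pow2_ge_0]). nra. }
    eapply Rle_trans; [exact Hb|].
    replace (2 * N * P + 2 * N * P * x) with (2 * N * 1 * (1 + x) * P) by ring.
    apply Rmult_le_compat_r; [lra|]. apply Rmult_le_compat_r; [lra|].
    apply Rmult_le_compat_l; lra. }
  assert (Hrm : 0 <= r ^ m) by (apply pow_le; exact Hz0).
  replace (r * (r ^ m * Q) * (1 - r ^ (2 * S m))) with (r * r ^ m * (Q * (1 - r ^ (2 * S m)))) by ring.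
  replace (2 * N * r ^ S m * P) with (r * r ^ m * (2 * N * P)) by (simpl; ring).
  apply Rmult_le_compat_l; [apply Rmult_le_pos; auto|exact Hmain].
Qed.

(** * The complex exponential *)

Lemma Cexp_plus (a b : C) : Cexp (a + b) = (Cexp a * Cexp b)%C.
Proof.
  unfold Cexp. rewrite re_plus. replace (Im (a + b)%C) with (Im a + Im b) by (destruct a, b; reflexivity).
  rewrite exp_plus, cos_plus, sin_plus.
  apply injective_projections; simpl; ring.
Qed.

Lemma Cexp_0 : Cexp 0 = 1%C.
Proof. unfold Cexp. simpl. rewrite exp_0, cos_0, sin_0. apply injective_projections; simpl; ring. Qed.

Lemma Cmod_Cexp (z : C) : Cmod (Cexp z) = exp (Re z).
Proof.
  unfold Cexp. rewrite Cmod_mult, Cmod_R, Rabs_pos_eq by (apply Rlt_le, exp_pos).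
  replace (Cmod (cos (Im z) + Ci * sin (Im z))%C) with 1; [ring|].
  apply Rsqr_inj; [lra|apply Cmod_ge_0|].
  rewrite !Rsqr_pow2, Cmod2_alt. generalize (sin2_cos2 (Im z)). rewrite !Rsqr_pow2.
  simpl. intros H. lra.
Qed.

Lemma Cexp_neq_0 (z : C) : Cexp z <> 0%C.
Proof. apply Cmod_gt_0. rewrite Cmod_Cexp. apply exp_pos. Qed.

Lemma Cexp_opp (z : C) : (Cexp (- z) * Cexp z)%C = 1%C.
Proof. rewrite <- Cexp_plus, <- Cexp_0. f_equal. ring. Qed.

Lemma Rabs_sin_le (y : R) : Rabs (sin y) <= Rabs y.
Proof.
  destruct (Rle_or_lt 0 y) as [H|H].
  - rewrite (Rabs_pos_eq y H).
    destruct (Req_dec y 0) as [->|Hy]; [rewrite sin_0, Rabs_R0; lra|].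
    destruct (Rle_or_lt y 1) as [H1|H1].
    + rewrite Rabs_pos_eq; [apply Rlt_le, sin_lt_x; lra|].
      apply sin_ge_0; generalize PI2_1; lra.
    + apply Rle_trans with 1; [|lra]. apply Rabs_le, SIN_bound.
  - rewrite <- (Rabs_Ropp (sin y)), <- sin_neg, (Rabs_left y H).
    destruct (Rle_or_lt (- y) 1) as [H1|H1].
    + rewrite Rabs_pos_eq; [apply Rlt_le, sin_lt_x; lra|].
      apply sin_ge_0; generalize PI2_1; lra.
    + apply Rle_trans with 1; [|lra]. apply Rabs_le, SIN_bound.
Qed.

Lemma Rabs_cos_minus_one_le (y : R) : Rabs (cos y - 1) <= y ^ 2.
Proof.
  replace y with (2 * (y / 2)) at 1 by field. rewrite cos_2a_sin.
  assert (H : Rabs (sin (y / 2)) <= Rabs (y / 2)) by apply Rabs_sin_le.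
  assert (H2 : sin (y / 2) ^ 2 <= (y / 2) ^ 2).
  { rewrite <- (pow2_abs (sin (y / 2))), <- (pow2_abs (y / 2)).
    apply pow_incr. split; [apply Rabs_pos|exact H]. }
  rewrite Rabs_left1; [|generalize (pow2_ge_0 (sin (y / 2))); simpl; lra].
  generalize (pow2_ge_0 y). simpl in *. lra.
Qed.

Lemma Rabs_sin_minus_id_le (y : R) : Rabs (sin y - y) <= y ^ 2 * Rabs y.
Proof.
  assert (Hpos : forall x, 0 < x -> Rabs (sin x - x) <= x ^ 2 * Rabs x).
  { intros x Hx. destruct (MVT_cor2 (fun x => sin x - x) (fun x => cos x - 1) 0 x Hx) as [c [Hc1 Hc2]].
    { intros c _. apply is_derive_Reals. auto_derive; [auto|ring]. }
    rewrite sin_0, !Rminus_0_r in Hc1. rewrite Hc1, Rabs_mult.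
    apply Rmult_le_compat_r; [apply Rabs_pos|].
    eapply Rle_trans; [apply Rabs_cos_minus_one_le|]. nra. }
  destruct (Rtotal_order y 0) as [H|[H|H]].
  - rewrite <- Rabs_Ropp. replace (- (sin y - y)) with (sin (- y) - - y) by (rewrite sin_neg; ring).
    replace (y ^ 2 * Rabs y) with ((- y) ^ 2 * Rabs (- y)) by (rewrite Rabs_Ropp; ring).
    apply Hpos; lra.
  - subst y. rewrite sin_0, Rminus_0_r, Rabs_R0. lra.
  - apply Hpos; exact H.
Qed.

(** The inequality exp y >= 1 + y at x and at -x traps exp x between 1 + x and 1 / (1 - x). *)
Lemma Rabs_exp_taylor_le (x : R) : Rabs x <= / 2 -> Rabs (exp x - 1 - x) <= 2 * x ^ 2.
Proof.
  intros Hx. apply Rabs_le_between in Hx.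
  assert (H1 := exp_ineq1_le x). assert (H2 := exp_ineq1_le (- x)).
  assert (H3 : exp x * exp (- x) = 1) by (rewrite <- exp_plus, Rplus_opp_r; apply exp_0).
  rewrite Rabs_pos_eq by lra.
  assert (H4 := exp_pos x).
  assert (H5 : exp x * (1 - x) <= 1) by nra.
  apply Rmult_le_reg_r with (1 - x); [lra|]. nra.
Qed.

Lemma is_Cderive_Cexp (z : C) : is_Cderive Cexp z (Cexp z).
Proof.
  apply is_Cderive_eps. intros eps He.
  assert (HE := exp_pos (Re z)).
  assert (Hd : 0 < Rmin (/ 2) (eps / (20 * exp (Re z)))).
  { apply Rmin_pos; [lra|]. apply Rdiv_lt_0_compat; lra. }
  exists (Rmin (/ 2) (eps / (20 * exp (Re z)))). split; [exact Hd|].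
  intros w Hw. assert (Hw1 := Rlt_le_trans _ _ _ Hw (Rmin_l _ _)).
  assert (Hw2 := Rlt_le_trans _ _ _ Hw (Rmin_r _ _)).
  set (h := (w - z)%C) in *.
  replace (Cexp w - Cexp z - Cexp z * h)%C with (Cexp z * (Cexp h - 1 - h))%C.
  2:{ replace w with (z + h)%C by (unfold h; ring). rewrite Cexp_plus. ring. }
  rewrite Cmod_mult, Cmod_Cexp.
  (* With |h| < 1/2 and exp x <= 3, the estimates below give at most 5 |h|^2 for the real part and 6
     |h|^2 for the imaginary part; 20 is a comfortable bound. *)
  assert (Hq : Cmod (Cexp h - 1 - h) <= 20 * Cmod h ^ 2).
  { eapply Rle_trans; [apply Cmod_le_Re_Im|].
    set (x := Re h). set (y := Im h).
    assert (Hx : Rabs x <= Cmod h) by apply re_le_Cmod.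
    assert (Hy : Rabs y <= Cmod h) by apply im_le_Cmod.
    replace (Re (Cexp h - 1 - h)%C) with (exp x * (cos y - 1) + (exp x - 1 - x))
      by (unfold Cexp, x, y; destruct h; simpl; ring).
    replace (Im (Cexp h - 1 - h)%C) with (exp x * (sin y - y) + (exp x - 1 - x) * y + x * y)
      by (unfold Cexp, x, y; destruct h; simpl; ring).
    assert (Hxx : x ^ 2 <= Cmod h ^ 2) by (rewrite <- pow2_abs; apply pow_incr; split; [apply Rabs_pos|auto]).
    assert (Hyy : y ^ 2 <= Cmod h ^ 2) by (rewrite <- pow2_abs; apply pow_incr; split; [apply Rabs_pos|auto]).
    assert (Hex : exp x <= 3).
    { apply Rle_trans with (exp 1); [|apply exp_le_3].
      destruct (Req_dec x 1) as [->|]; [lra|]. apply Rlt_le, exp_increasing.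
      generalize (Rle_abs x). lra. }
    assert (Hex0 := exp_pos x).
    assert (B1 := Rabs_exp_taylor_le x ltac:(lra)).
    assert (B2 := Rabs_cos_minus_one_le y). assert (B3 := Rabs_sin_minus_id_le y).
    assert (T1 := Rabs_triang (exp x * (cos y - 1)) (exp x - 1 - x)).
    assert (T2 := Rabs_triang (exp x * (sin y - y) + (exp x - 1 - x) * y) (x * y)).
    assert (T3 := Rabs_triang (exp x * (sin y - y)) ((exp x - 1 - x) * y)).
    rewrite (Rabs_mult x y) in T2. rewrite (Rabs_mult (exp x - 1 - x) y) in T3.
    rewrite (Rabs_mult (exp x)) in T1, T3. rewrite (Rabs_pos_eq (exp x)) in * by lra.
    assert (Hay := Rabs_pos y). assert (Hax := Rabs_pos x).
    assert (exp x * Rabs (cos y - 1) <= 3 * Cmod h ^ 2)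
      by (apply Rmult_le_compat; [lra|apply Rabs_pos|lra|lra]).
    assert (y ^ 2 * Rabs y <= Cmod h ^ 2 * 1)
      by (apply Rmult_le_compat; [apply pow2_ge_0|lra|lra|lra]).
    assert (exp x * Rabs (sin y - y) <= 3 * Cmod h ^ 2)
      by (apply Rmult_le_compat; [lra|apply Rabs_pos|lra|lra]).
    assert (Rabs (exp x - 1 - x) * Rabs y <= 2 * Cmod h ^ 2 * 1)
      by (apply Rmult_le_compat; [apply Rabs_pos|lra|lra|lra]).
    assert (Rabs x * Rabs y <= Cmod h * Cmod h) by (apply Rmult_le_compat; lra).
    generalize (pow2_ge_0 (Cmod h)). lra. }
  assert (Hh := Cmod_ge_0 h).
  apply Rmult_lt_compat_r with (r := 20 * exp (Re z)) in Hw2; [|lra].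
  replace (eps / (20 * exp (Re z)) * (20 * exp (Re z))) with eps in Hw2 by (field; lra).
  apply Rle_trans with (exp (Re z) * (20 * Cmod h ^ 2)); [apply Rmult_le_compat_l; lra|].
  replace (exp (Re z) * (20 * Cmod h ^ 2)) with (Cmod h * (20 * exp (Re z)) * Cmod h) by ring.
  apply Rmult_le_compat_r; [exact Hh|]. apply Rlt_le; exact Hw2.
Qed.

(** The mean value theorem fails for complex values, so the segment from b to a is projected on the
    direction of D = Cexp a - Cexp b: the increment of Re (conj D Cexp) is |D|^2, and one factor |D|
    cancels. *)
Lemma Cexp_lipschitz (t : R) (a b : C) :
  Cmod a <= t -> Cmod b <= t -> Cmod (Cexp a - Cexp b) <= exp t * Cmod (a - b).
Proof.
  intros Ha Hb. set (D := (Cexp a - Cexp b)%C).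
  destruct (MVT_cor2 (fun s => Re (Cconj D * Cexp (b + RtoC s * (a - b)))%C)
    (fun s => Re (Cconj D * Cexp (b + RtoC s * (a - b)) * (a - b))%C) 0 1 Rlt_0_1)
    as [c [Hc1 Hc2]].
  { intros s _. apply is_derive_Reals.
    apply (is_Cderive_line (fun z => Cconj D * Cexp z)%C).
    apply is_Cderive_scal, is_Cderive_Cexp. }
  assert (HD : Re (Cconj D * D)%C = Cmod D ^ 2)
    by (rewrite Cmod2_alt; destruct D; simpl; ring).
  assert (Hm : Cmod D ^ 2 = Re (Cconj D * Cexp (b + RtoC c * (a - b)) * (a - b))%C).
  { rewrite <- HD. replace (Re (Cconj D * Cexp (b + c * (a - b)) * (a - b))%C)
      with (Re (Cconj D * Cexp (b + c * (a - b)) * (a - b))%C * (1 - 0)) by ring.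
    rewrite <- Hc1. unfold D at 2.
    replace (b + RtoC 1 * (a - b))%C with a by ring. replace (b + RtoC 0 * (a - b))%C with b by ring.
    replace (Cconj D * (Cexp a - Cexp b))%C with (Cconj D * Cexp a + - (Cconj D * Cexp b))%C by ring.
    rewrite re_plus, re_opp. ring. }
  assert (Hle : Cmod D ^ 2 <= Cmod D * (exp t * Cmod (a - b))).
  { rewrite Hm. eapply Rle_trans; [apply Rle_abs|]. eapply Rle_trans; [apply re_le_Cmod|].
    rewrite !Cmod_mult, Cmod_conj, Cmod_Cexp, Rmult_assoc.
    apply Rmult_le_compat_l; [apply Cmod_ge_0|]. apply Rmult_le_compat_r; [apply Cmod_ge_0|].
    assert (Hr : Re (b + RtoC c * (a - b))%C <= t).
    { eapply Rle_trans; [apply Rle_abs|]. eapply Rle_trans; [apply re_le_Cmod|].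
      replace (b + RtoC c * (a - b))%C with (RtoC (1 - c) * b + RtoC c * a)%C
        by (rewrite RtoC_minus; ring).
      eapply Rle_trans; [apply Cmod_triangle|].
      rewrite !Cmod_mult, !Cmod_R, !Rabs_pos_eq by lra. nra. }
    destruct Hr as [Hr|Hr]; [apply Rlt_le, exp_increasing; exact Hr|rewrite Hr; lra]. }
  destruct (Rle_lt_or_eq_dec _ _ (Cmod_ge_0 D)) as [H|H].
  - apply Rmult_le_reg_l with (Cmod D); [exact H|]. simpl in Hle. lra.
  - rewrite <- H. apply Rmult_le_pos; [apply Rlt_le, exp_pos|apply Cmod_ge_0].
Qed.

(** * The Lambert function *)

Lemma exp_le_compat (x y : R) : x <= y -> exp x <= exp y.
Proof. intros [H| ->]; [apply Rlt_le, exp_increasing; exact H|lra]. Qed.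

(** Telescoping: the partial sum through index n is a(n + 1), since a(0) = 0. *)
Lemma is_Cseries_cauchy_limit (a : nat -> C) (l : C) :
  is_Cseries (fun k => a (S k) - a k)%C l -> a 0%nat = 0%C ->
  forall eps, 0 < eps -> exists N, forall n, (N <= n)%nat -> Cmod (a (S n) - l) < eps.
Proof.
  intros H Ha eps He.
  destruct (proj1 (filterlim_locally_ball_norm (K := C_AbsRing) (U := C_NormedModule) _ _) H
    (mkposreal eps He)) as [N HN].
  exists N. intros n Hn. specialize (HN n Hn).
  replace (a (S n)) with (sum_n (G := C_AbelianMonoid) (fun k => a (S k) - a k)%C n); [exact HN|].
  clear - Ha. induction n as [|n IH].
  - rewrite sum_O, Ha. change (@eq C (a 1%nat - 0)%C (a 1%nat)). ring.
  - rewrite sum_Sn, IH.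
    change (@eq C (a (S n) + (a (S (S n)) - a (S n)))%C (a (S (S n)))). ring.
Qed.

(** The bound on u serves twice: since |exp(-w)| <= e^t for |w| <= t, it makes w |-> u e^(-w) map
    the disk of radius t into itself and gives it the Lipschitz constant t < 1. Iteration starts at
    0, and successive differences are at most t^k. *)
Lemma lambert_exists (u : C) (t : R) :
  0 <= t < 1 -> Cmod u <= t * exp (- t) -> exists w, Cmod w <= t /\ (w * Cexp w)%C = u.
Proof.
  intros Ht Hu.
  set (G := fun w : C => (u * Cexp (- w))%C).
  assert (Hte : exp (- t) * exp t = 1) by (rewrite <- exp_plus, Rplus_opp_l; apply exp_0).
  assert (Het := exp_pos t).
  assert (HG : forall w, Cmod w <= t -> Cmod (G w) <= t).
  { intros w Hw. unfold G. rewrite Cmod_mult, Cmod_Cexp.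
    apply Rle_trans with (t * exp (- t) * exp t).
    - apply Rmult_le_compat; [apply Cmod_ge_0|apply Rlt_le, exp_pos|exact Hu|].
      apply exp_le_compat. eapply Rle_trans; [apply Rle_abs|].
      eapply Rle_trans; [apply re_le_Cmod|]. rewrite Cmod_opp. exact Hw.
    - rewrite Rmult_assoc, Hte. lra. }
  assert (HGl : forall a b, Cmod a <= t -> Cmod b <= t -> Cmod (G a - G b) <= t * Cmod (a - b)).
  { intros a b Ha Hb. unfold G.
    replace (u * Cexp (- a) - u * Cexp (- b))%C with (u * (Cexp (- a) - Cexp (- b)))%C by ring.
    rewrite Cmod_mult.
    assert (HL := Cexp_lipschitz t (- a) (- b)). rewrite !Cmod_opp in HL.
    specialize (HL Ha Hb).
    replace (Cmod (- a - - b)%C) with (Cmod (a - b)%C) in HL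
      by (rewrite <- Cmod_opp; f_equal; ring).
    apply Rle_trans with (t * exp (- t) * (exp t * Cmod (a - b))).
    - apply Rmult_le_compat; [apply Cmod_ge_0|apply Cmod_ge_0|exact Hu|exact HL].
    - replace (t * exp (- t) * (exp t * Cmod (a - b)))
        with (t * (exp (- t) * exp t) * Cmod (a - b)) by ring.
      rewrite Hte. lra. }
  set (a := fun k => Nat.iter k G 0%C).
  assert (Ha : forall k, Cmod (a k) <= t).
  { induction k as [|k IH]; [simpl; rewrite Cmod_0; lra|apply HG; exact IH]. }
  assert (Had : forall k, Cmod (a (S k) - a k) <= t ^ k).
  { induction k as [|k IH].
    - simpl pow. apply Rle_trans with t; [|lra].
      replace (a 1%nat - a 0%nat)%C with (a 1%nat) by (simpl; ring). apply Ha.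
    - change (a (S (S k)) - a (S k))%C with (G (a (S k)) - G (a k))%C.
      eapply Rle_trans; [apply HGl; apply Ha|]. simpl. apply Rmult_le_compat_l; [lra|exact IH]. }
  destruct (ex_Cseries_le _ _ Had) as [l Hl].
  { apply ex_series_geom. rewrite Rabs_pos_eq; lra. }
  assert (Hlim := is_Cseries_cauchy_limit a l Hl eq_refl).
  assert (Hlt : Cmod l <= t).
  { apply le_epsilon. intros e He. destruct (Hlim e He) as [N HN].
    specialize (HN N (le_n N)).
    replace l with (a (S N) + - (a (S N) - l))%C by ring.
    eapply Rle_trans; [apply Cmod_triangle|]. rewrite Cmod_opp. generalize (Ha (S N)). lra. }
  assert (Hfix : l = G l).
  { apply Ceq_minus, Cmod_eq_0, Rle_antisym; [|apply Cmod_ge_0].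
    apply le_epsilon. intros e He. rewrite Rplus_0_l.
    destruct (Hlim (e / 2) ltac:(lra)) as [N HN].
    assert (H1 := HN N (le_n N)). assert (H2 := HN (S N) ltac:(lia)).
    change (a (S (S N))) with (G (a (S N))) in H2.
    replace (l - G l)%C with (- (G (a (S N)) - l) + (G (a (S N)) - G l))%C by ring.
    eapply Rle_trans; [apply Cmod_triangle|]. rewrite Cmod_opp.
    generalize (HGl (a (S N)) l (Ha _) Hlt) (Cmod_ge_0 (a (S N) - l)%C). nra. }
  exists l. split; [exact Hlt|].
  rewrite Hfix at 1. unfold G. rewrite <- Cmult_assoc, Cexp_opp. ring.
Qed.

(** Subtracting the fixed-point equations gives w' - w = u (e^(-w') - e^(-w)) + (v - u) e^(-w'). The
    first term is at most t |w' - w| and moves to the left. *)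
Lemma lambert_lipschitz (u v w w' : C) (t : R) :
  0 <= t < 1 -> Cmod u <= t * exp (- t) -> Cmod w <= t -> Cmod w' <= t ->
  (w * Cexp w)%C = u -> (w' * Cexp w')%C = v ->
  (1 - t) * Cmod (w' - w) <= exp t * Cmod (v - u).
Proof.
  intros Ht Hu Hw Hw' Ew Ew'.
  assert (Hte : exp (- t) * exp t = 1) by (rewrite <- exp_plus, Rplus_opp_l; apply exp_0).
  assert (Fw : w = (u * Cexp (- w))%C)
    by (rewrite <- Ew, <- Cmult_assoc, (Cmult_comm (Cexp w)), Cexp_opp; ring).
  assert (Fw' : w' = (v * Cexp (- w'))%C)
    by (rewrite <- Ew', <- Cmult_assoc, (Cmult_comm (Cexp w')), Cexp_opp; ring).
  assert (E : (w' - w)%C = (u * (Cexp (- w') - Cexp (- w)) + (v - u) * Cexp (- w'))%C).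
  { rewrite Fw at 1. rewrite Fw' at 1. ring. }
  assert (HL := Cexp_lipschitz t (- w') (- w)). rewrite !Cmod_opp in HL.
  specialize (HL Hw' Hw).
  replace (Cmod (- w' - - w)%C) with (Cmod (w' - w)%C) in HL
    by (rewrite <- Cmod_opp; f_equal; ring).
  assert (H1 : Cmod u * Cmod (Cexp (- w') - Cexp (- w)) <= t * Cmod (w' - w)).
  { apply Rle_trans with (t * exp (- t) * (exp t * Cmod (w' - w))).
    - apply Rmult_le_compat; [apply Cmod_ge_0|apply Cmod_ge_0|exact Hu|exact HL].
    - replace (t * exp (- t) * (exp t * Cmod (w' - w)))
        with (t * (exp (- t) * exp t) * Cmod (w' - w)) by ring.
      rewrite Hte. lra. }
  assert (H2 : Cmod (Cexp (- w')) <= exp t).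
  { rewrite Cmod_Cexp. apply exp_le_compat. eapply Rle_trans; [apply Rle_abs|].
    eapply Rle_trans; [apply re_le_Cmod|]. rewrite Cmod_opp. exact Hw'. }
  assert (H3 : Cmod (w' - w) <= Cmod u * Cmod (Cexp (- w') - Cexp (- w))
      + Cmod (v - u) * Cmod (Cexp (- w'))).
  { rewrite E at 1. rewrite <- !Cmod_mult. apply Cmod_triangle. }
  generalize (Cmod_ge_0 (v - u)%C). nra.
Qed.

(* [x <= t exp (- t)] holds for this [t] because [e x = 1 - (1 - t)^2] and
   [exp (1 - t) >= 2 - t]. *)
Definition lambert_bound (x : R) : R := 1 - sqrt (1 - exp 1 * x).

Lemma lambert_bound_spec (x : R) :
  0 <= x < exp (- 1) ->
  0 <= lambert_bound x < 1 /\ x <= lambert_bound x * exp (- lambert_bound x).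
Proof.
  intros Hx. unfold lambert_bound.
  assert (Hee : exp 1 * exp (- 1) = 1) by (rewrite <- exp_plus, Rplus_opp_r; apply exp_0).
  assert (He := exp_pos 1). assert (He' := exp_pos (- 1)).
  assert (Hy : 0 < 1 - exp 1 * x <= 1) by nra.
  assert (Hs := sqrt_lt_R0 _ (proj1 Hy)).
  assert (Hs1 : sqrt (1 - exp 1 * x) <= 1) by (apply Rle_trans with (sqrt 1); [apply sqrt_le_1; lra|rewrite sqrt_1; lra]).
  assert (Hsq := sqrt_sqrt (1 - exp 1 * x) ltac:(lra)).
  set (r := sqrt (1 - exp 1 * x)) in *.
  split; [lra|].
  replace (- (1 - r)) with (- 1 + r) by ring. rewrite exp_plus.
  assert (H := exp_ineq1_le r).
  replace x with (exp (- 1) * (1 - r * r)).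
  2:{ rewrite Hsq. replace (exp (-1) * (1 - (1 - exp 1 * x))) with ((exp 1 * exp (-1)) * x) by ring.
      rewrite Hee. ring. }
  replace ((1 - r) * (exp (- 1) * exp r)) with (exp (- 1) * ((1 - r) * exp r)) by ring.
  apply Rmult_le_compat_l; [lra|]. nra.
Qed.

Lemma lambert_bound_le (x y : R) :
  x <= y -> y < exp (- 1) -> lambert_bound x <= lambert_bound y.
Proof.
  intros Hxy Hy. unfold lambert_bound.
  assert (Hee : exp 1 * exp (- 1) = 1) by (rewrite <- exp_plus, Rplus_opp_r; apply exp_0).
  assert (He := exp_pos 1).
  assert (sqrt (1 - exp 1 * y) <= sqrt (1 - exp 1 * x)); [|lra].
  apply sqrt_le_1; nra.
Qed.

(** Solutions are chosen pointwise, but subject to the explicit bound [lambert_bound]. This forces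
    W(0) = 0 and |W| < 1, and by monotonicity supplies one t < 1 for all v near u, so that W is
    Lipschitz there. The derivative then follows from that of w e^w, which is (1 + w) e^w and
    nonzero because |w| < 1. *)
Lemma lambert_function :
  exists W : C -> C, W 0%C = 0%C /\
    forall u, Cmod u < exp (- 1) ->
      Cmod (W u) < 1 /\ (W u * Cexp (W u))%C = u /\ exists l, is_Cderive W u l.
Proof.
  destruct (choice (fun u w : C => Cmod u < exp (- 1) ->
      Cmod w <= lambert_bound (Cmod u) /\ (w * Cexp w)%C = u)) as [W HW].
  { intros u. destruct (Rlt_dec (Cmod u) (exp (- 1))) as [H|H].
    - destruct (lambert_bound_spec (Cmod u) (conj (Cmod_ge_0 u) H)) as [H1 H2].
      destruct (lambert_exists u _ H1 H2) as [w Hw]. exists w. auto.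
    - exists 0%C. intros; contradiction. }
  exists W. split.
  { assert (H0 : Cmod 0 < exp (- 1)) by (rewrite Cmod_0; apply exp_pos).
    apply Cmod_eq_0, Rle_antisym; [|apply Cmod_ge_0].
    eapply Rle_trans; [apply (HW 0%C H0)|].
    unfold lambert_bound. rewrite Cmod_0, Rmult_0_r, Rminus_0_r, sqrt_1. lra. }
  intros u Hu. assert (Hu0 := Cmod_ge_0 u).
  destruct (HW u Hu) as [Hw Ew].
  destruct (lambert_bound_spec (Cmod u) (conj Hu0 Hu)) as [Hb _].
  split; [lra|]. split; [exact Ew|].
  (* A radius strictly between |u| and 1/e, so that v can vary around u with the same t. *)
  set (x := (Cmod u + exp (- 1)) / 2).
  assert (Hx : Cmod u < x < exp (- 1)) by (unfold x; lra).
  destruct (lambert_bound_spec x ltac:(lra)) as [Ht Hxt].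
  set (t := lambert_bound x) in *.
  assert (Hut : Cmod u <= t * exp (- t)) by lra.
  assert (Hwt : Cmod (W u) <= t).
  { eapply Rle_trans; [exact Hw|]. apply lambert_bound_le; lra. }
  set (w0 := W u) in *.
  set (A := ((1 + w0) * Cexp w0)%C).
  assert (HA : A <> 0%C).
  { apply Cmult_neq_0; [|apply Cexp_neq_0]. intros H.
    assert (w0 = (- (1))%C) by (replace w0 with ((1 + w0) + - (1))%C by ring; rewrite H; ring).
    rewrite H0, Cmod_opp, Cmod_1 in Hwt. lra. }
  assert (HF : is_Cderive (fun w => w * Cexp w)%C w0 A).
  { unfold A. replace ((1 + w0) * Cexp w0)%C with (1 * Cexp w0 + w0 * Cexp w0)%C by ring.
    apply (is_Cderive_mult (fun w => w)); [apply is_Cderive_id|apply is_Cderive_Cexp]. }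
  exists (/ A)%C. apply is_Cderive_eps. intros eps He.
  assert (HmA : 0 < Cmod A) by (apply Cmod_gt_0; exact HA).
  set (L := exp t / (1 - t)).
  assert (HL : 0 < L) by (apply Rdiv_lt_0_compat; [apply exp_pos|lra]).
  assert (He' : 0 < eps * Cmod A / L) by (apply Rdiv_lt_0_compat; [apply Rmult_lt_0_compat|]; auto).
  destruct (proj1 (is_Cderive_eps _ _ _) HF _ He') as [d [Hd Hd']].
  exists (Rmin (x - Cmod u) (d / L)).
  assert (HdL : 0 < d / L) by (apply Rdiv_lt_0_compat; auto).
  split; [apply Rmin_pos; lra|]. intros v Hv.
  assert (Hv1 := Rlt_le_trans _ _ _ Hv (Rmin_l _ _)).
  assert (Hv2 := Rlt_le_trans _ _ _ Hv (Rmin_r _ _)).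
  assert (Hvx : Cmod v <= x) by (apply Rlt_le, (Cmod_open x u); lra).
  assert (Hve : Cmod v < exp (- 1)) by lra.
  destruct (HW v Hve) as [Hwv Ewv].
  assert (Hwvt : Cmod (W v) <= t) by (eapply Rle_trans; [exact Hwv|]; apply lambert_bound_le; lra).
  assert (Hlip : Cmod (W v - w0) <= L * Cmod (v - u)).
  { assert (H := lambert_lipschitz u v w0 (W v) t Ht Hut Hwt Hwvt Ew Ewv).
    apply Rmult_le_reg_l with (1 - t); [lra|].
    replace ((1 - t) * (L * Cmod (v - u))) with (exp t * Cmod (v - u)) by (unfold L; field; lra).
    exact H. }
  assert (Hd2 : Cmod (W v - w0) < d).
  { eapply Rle_lt_trans; [exact Hlip|].
    apply Rmult_lt_compat_l with (r := L) in Hv2; [|exact HL].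
    replace (L * (d / L)) with d in Hv2 by (field; lra). exact Hv2. }
  specialize (Hd' (W v) Hd2). rewrite Ewv, Ew in Hd'.
  (* The remainder of W is -1/A times the remainder of w e^w. *)
  fold w0. replace (W v - w0 - / A * (v - u))%C with (- (/ A * (v - u - A * (W v - w0))))%C by (field; exact HA).
  rewrite Cmod_opp, Cmod_mult, Cmod_inv by exact HA.
  apply Rmult_le_reg_l with (Cmod A); [exact HmA|].
  rewrite <- Rmult_assoc, Rinv_r, Rmult_1_l by lra.
  eapply Rle_trans; [exact Hd'|].
  apply Rle_trans with (eps * Cmod A / L * (L * Cmod (v - u))).
  - apply Rmult_le_compat_l; [lra|exact Hlip].
  - right. field. lra.
Qed.

(* If [y <> 0], vanishing imaginary part forces [x = - y cos y / sin y], so that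
   [x^2 + y^2 = (y / sin y)^2 >= 1]: hence [w] is real. *)
Lemma real_value_ge_of_in_disk (w : C) (u : R) :
  in_disk w -> (w * Cexp w)%C = RtoC u -> - exp (- 1) <= u.
Proof.
  unfold in_disk. intros Hw H. destruct w as [x y].
  assert (Hre := f_equal Re H). assert (Him := f_equal Im H). clear H.
  unfold Cexp in Hre, Him. simpl in Hre, Him.
  assert (Hm : x ^ 2 + y ^ 2 < 1).
  { generalize (Cmod2_alt (x, y)) (Cmod_ge_0 (x, y)). simpl Re. simpl Im. nra. }
  assert (Hex := exp_pos x).
  assert (H1 : x * sin y + y * cos y = 0).
  { apply Rmult_eq_reg_l with (exp x); [|lra]. rewrite Rmult_0_r, <- Him. ring. }
  assert (Hsc := sin2_cos2 y). rewrite !Rsqr_pow2 in Hsc.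
  assert (Hy : y = 0).
  { destruct (Req_dec y 0) as [|Hy]; [assumption|exfalso].
    assert (Hs : sin y ^ 2 <= y ^ 2).
    { rewrite <- (pow2_abs (sin y)), <- (pow2_abs y). apply pow_incr.
      split; [apply Rabs_pos|apply Rabs_sin_le]. }
    assert (H2 : (x * sin y) ^ 2 = (y * cos y) ^ 2) by (replace (x * sin y) with (- (y * cos y)) by lra; ring).
    assert (H3 : sin y ^ 2 * (x ^ 2 + y ^ 2) = y ^ 2)
      by (replace (sin y ^ 2 * (x ^ 2 + y ^ 2)) with ((x * sin y) ^ 2 + y ^ 2 * sin y ^ 2) by ring;
          rewrite H2; nra).
    assert (Hy2 : 0 < y ^ 2) by nra.
    assert (0 <= sin y ^ 2) by apply pow2_ge_0. nra. }
  subst y. rewrite sin_0, cos_0 in Hre.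
  assert (Hu : u = x * exp x) by (rewrite <- Hre; ring). rewrite Hu.
  (* For real x, exp(-1 - x) >= -x; multiplying by exp x gives x exp x >= -exp(-1). *)
  assert (H2 := exp_ineq1_le (- 1 - x)).
  assert (H3 : exp (- 1) = exp (- 1 - x) * exp x) by (rewrite <- exp_plus; f_equal; ring).
  rewrite H3. nra.
Qed.

(** * The radius *)

Lemma in_disk_scale (r : R) (z : C) : 0 < r <= 1 -> in_disk z -> in_disk (RtoC r * z)%C.
Proof.
  unfold in_disk. intros Hr Hz. rewrite Cmod_mult, Cmod_R, Rabs_pos_eq by lra.
  generalize (Cmod_ge_0 z). nra.
Qed.

Lemma is_Cderive_dilate (r : R) (f : C -> C) (z l : C) :
  0 < r -> is_Cderive f (RtoC r * z)%C l -> is_Cderive (dilate r f) z l.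
Proof.
  intros Hr H. assert (Hr0 : RtoC r <> 0%C) by (intros E; apply RtoC_inj in E; lra).
  apply is_Cderive_ext with (fun w => / RtoC r * f (RtoC r * w))%C.
  { intros w. unfold dilate, Cdiv. apply Cmult_comm. }
  replace l with (/ RtoC r * (l * (RtoC r * 1)))%C by (field; exact Hr0).
  apply is_Cderive_scal, (is_Cderive_comp f (fun w => RtoC r * w)%C); [exact H|].
  apply is_Cderive_scal, is_Cderive_id.
Qed.

Lemma class_A_dilate (n : nat) (r : R) (f : C -> C) :
  0 < r <= 1 -> class_A n f -> class_A n (dilate r f).
Proof.
  intros Hr [_ [b [Hf [Hb0 [Hb1 Hb]]]]].
  assert (Hr0 : RtoC r <> 0%C) by (intros E; apply RtoC_inj in E; lra).
  assert (He : has_expansion (dilate r f) (fun k => b k * RtoC r ^ k / RtoC r)%C).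
  { intros z Hz. apply is_pseries_Cseries.
    assert (H := proj1 (is_pseries_Cseries _ _ _) (Hf _ (in_disk_scale r z Hr Hz))).
    apply (is_Cseries_scal (/ RtoC r)%C) in H. unfold dilate, Cdiv. rewrite Cmult_comm.
    revert H. apply is_Cseries_ext. intros k. rewrite Cpow_mult_l. ring. }
  split; [exact (has_expansion_analytic _ _ He)|].
  eexists; split; [exact He|]. split; [|split].
  - rewrite Hb0. unfold Cdiv. ring.
  - rewrite Hb1, Cpow_1_r. field. exact Hr0.
  - intros k Hk. rewrite (Hb k Hk). unfold Cdiv. ring.
Qed.

Lemma class_A_le (n m : nat) (f : C -> C) : (m <= n)%nat -> class_A n f -> class_A m f.
Proof.
  intros Hmn [Ha [b [Hf [Hb0 [Hb1 Hb]]]]]. split; [exact Ha|].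
  exists b. repeat split; auto. intros k Hk. apply Hb. lia.
Qed.

(** Re p <= |p| turns the derivative bound into one for z p' / p. Strictness comes from |z| < r,
    since 2 n e s + s^2 increases with s = |z|^n. *)
Lemma class_P_log_derivative_lt (n : nat) (p : C -> C) (r : R) (z : C) :
  (1 <= n)%nat -> class_P n p -> 0 < r <= 1 ->
  2 * INR n * r ^ n * exp 1 <= 1 - (r ^ n) ^ 2 -> Cmod z < r ->
  Cmod (z * C_derive p z / p z) < exp (- 1).
Proof.
  intros Hn Hp Hr Hrn Hz.
  assert (Hzd : in_disk z) by (unfold in_disk; lra).
  assert (H := class_P_log_derivative_bound n p z Hn Hp Hzd).
  destruct Hp as [_ [_ Hpos]]. specialize (Hpos z Hzd).
  assert (Hz0 := Cmod_ge_0 z).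
  assert (HP : Re (p z) <= Cmod (p z)) by (eapply Rle_trans; [apply Rle_abs|apply re_le_Cmod]).
  assert (HpC : p z <> 0%C) by (apply Cmod_gt_0; lra).
  rewrite Cmod_div by exact HpC.
  set (D := Cmod (z * C_derive p z)) in *. set (P := Cmod (p z)) in *.
  assert (Hs : Cmod z ^ n < r ^ n)
    by (destruct n as [|m]; [lia|]; apply pow_S_lt; lra).
  assert (Hs0 : 0 <= Cmod z ^ n) by (apply pow_le; lra).
  replace (Cmod z ^ (2 * n)) with ((Cmod z ^ n) ^ 2) in H
    by (rewrite Nat.mul_comm, pow_mult; reflexivity).
  set (s := Cmod z ^ n) in *. set (t := r ^ n) in *.
  assert (HN : 1 <= INR n) by (apply (le_INR 1); exact Hn).
  assert (Hee : exp 1 * exp (- 1) = 1) by (rewrite <- exp_plus, Rplus_opp_r; apply exp_0).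
  assert (He := exp_pos 1). assert (He' := exp_pos (- 1)).
  assert (HD : D * (1 - s ^ 2) <= 2 * INR n * s * P).
  { eapply Rle_trans; [exact H|]. apply Rmult_le_compat_l; [|exact HP].
    apply Rmult_le_pos; lra. }
  assert (Hst : 2 * INR n * s < exp (- 1) * (1 - s ^ 2)).
  { apply Rmult_lt_reg_r with (exp 1); [exact He|].
    replace (exp (- 1) * (1 - s ^ 2) * exp 1) with (exp 1 * exp (- 1) * (1 - s ^ 2)) by ring.
    rewrite Hee.
    assert (2 * INR n * s * exp 1 < 2 * INR n * t * exp 1)
      by (apply Rmult_lt_compat_r; [exact He|]; apply Rmult_lt_compat_l; lra).
    nra. }
  assert (H1s : 0 < 1 - s ^ 2).
  { assert (0 < exp (- 1) * (1 - s ^ 2)) by nra. nra. }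
  apply Rmult_lt_reg_r with (P * (1 - s ^ 2)); [apply Rmult_lt_0_compat; lra|].
  replace (D / P * (P * (1 - s ^ 2))) with (D * (1 - s ^ 2)) by (field; lra).
  eapply Rle_lt_trans; [exact HD|].
  replace (exp (- 1) * (P * (1 - s ^ 2))) with (exp (- 1) * (1 - s ^ 2) * P) by ring.
  apply Rmult_lt_compat_r; lra.
Qed.

Lemma class_S_wp_n_dilate (n : nat) (r : R) (f : C -> C) :
  (1 <= n)%nat -> 0 < r <= 1 -> 2 * INR n * r ^ n * exp 1 <= 1 - (r ^ n) ^ 2 ->
  class_F n f -> class_S_wp_n n (dilate r f).
Proof.
  intros Hn Hr Hrn [HA [p [HP Hfp]]].
  assert (HAr := class_A_dilate n r f Hr HA).
  split; [exact HAr|]. split; [exact (class_A_le n 1 _ Hn HAr)|].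
  destruct lambert_function as [W [HW0 HW]].
  assert (Hr0 : RtoC r <> 0%C) by (intros E; apply RtoC_inj in E; lra).
  assert (HP' := HP). destruct HP' as [_ [[c [Hp _]] Hpos]].
  destruct (has_expansion_derivative p c Hp) as [Dp Hp1].
  destruct (has_expansion_derivative _ _ Hp1) as [Dp1 _].
  assert (Hpn : forall z, in_disk z -> p z <> 0%C).
  { intros z Hz E. assert (H := Hpos z Hz). rewrite E in H. simpl in H. lra. }
  set (g := fun z => (z * C_derive p z / p z)%C).
  assert (Hg : forall z, in_disk z -> Cmod (g (RtoC r * z)%C) < exp (- 1)).
  { intros z Hz. apply (class_P_log_derivative_lt n p r); auto.
    rewrite Cmod_mult, Cmod_R, Rabs_pos_eq by lra. unfold in_disk in Hz. nra. }
  (* For the dilation of f = z p, the quotient z f' / f at z equals 1 + g(r z). *)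
  exists (fun z => W (g (RtoC r * z)%C)). split; [split; [|split]|].
  - intros z Hz. assert (Hrz := in_disk_scale r z Hr Hz).
    destruct (HW _ (Hg z Hz)) as [_ [_ [l Hl]]].
    eexists. apply (is_Cderive_comp W (fun z => g (RtoC r * z)%C)); [exact Hl|].
    apply (is_Cderive_comp g (fun z => RtoC r * z)%C).
    + apply is_Cderive_div; [apply Hpn; exact Hrz| |apply Dp; exact Hrz].
      apply is_Cderive_mult; [apply is_Cderive_id|apply Dp1; exact Hrz].
    + apply is_Cderive_scal, is_Cderive_id.
  - cbv beta. rewrite Cmult_0_r. unfold g. rewrite Cmult_0_l. unfold Cdiv. rewrite Cmult_0_l. exact HW0.
  - intros z Hz. apply (HW _ (Hg z Hz)).
  - intros z Hz Hz0. assert (Hrz := in_disk_scale r z Hr Hz).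
    assert (Hfd : is_Cderive f (RtoC r * z)%C
      (1 * p (RtoC r * z) + RtoC r * z * C_derive p (RtoC r * z))%C).
    { apply is_Cderive_ext_disk with (fun w => w * p w)%C; [exact Hrz| |].
      - intros w Hw. symmetry. apply Hfp, Hw.
      - apply (is_Cderive_mult (fun w => w)); [apply is_Cderive_id|apply Dp; exact Hrz]. }
    eexists. split; [apply (is_Cderive_dilate r f z _ (proj1 Hr) Hfd)|].
    assert (Hpz := Hpn _ Hrz).
    unfold dilate. rewrite (Hfp _ Hrz).
    split.
    + unfold Cdiv. repeat apply Cmult_neq_0; auto.
      intros E. apply C1_nz. rewrite <- (Cinv_r (RtoC r) Hr0), E. ring.
    + unfold wp. rewrite (proj1 (proj2 (HW _ (Hg z Hz)))). unfold g. field. auto.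
Qed.

(** * The extremal function *)

(** Taylor coefficients of 1 / (1 + z^n). *)
Definition alternating_coef (n k : nat) : C :=
  if (k mod n =? 0)%nat then ((- (1)) ^ (k / n))%C else 0%C.

Lemma is_Cseries_delta (z : C) :
  is_Cseries (fun k => (if (k =? 0)%nat then 1 else 0) * z ^ k)%C 1%C.
Proof.
  set (a := fun k => ((if (k =? 0)%nat then 1 else 0) * z ^ k)%C).
  destruct (ex_Cseries_le (fun _ => 0%C) (fun k => (/ 2) ^ k)) as [l Hl].
  { intros k. rewrite Cmod_0. apply pow_le. lra. }
  { apply ex_series_geom. rewrite Rabs_pos_eq; lra. }
  apply (is_Cseries_scal 0%C) in Hl. rewrite (Cmult_0_l l) in Hl.
  assert (H : is_Cseries (fun k => a (S k)) 0%C).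
  { revert Hl. apply is_Cseries_ext. intros k. unfold a. simpl. ring. }
  apply is_Cseries_shift in H.
  replace (a 0%nat + 0)%C with (RtoC 1) in H by (unfold a; simpl; ring). exact H.
Qed.

Lemma is_Cseries_pad (n : nat) (a : nat -> C) (l : C) :
  is_Cseries a l -> is_Cseries (fun k => if (k <? n)%nat then 0%C else a (k - n)%nat) l.
Proof.
  intros H. induction n as [|n IH].
  - revert H. apply is_Cseries_ext. intros k. rewrite Nat.sub_0_r. reflexivity.
  - apply (is_Cseries_shift (fun k => if (k <? S n)%nat then 0%C else a (k - S n)%nat)) in IH.
    cbv beta in IH. simpl (if (0 <? S n)%nat then _ else _) in IH. rewrite Cplus_0_l in IH. exact IH.
Qed.

(** The sum g of the series satisfies (1 + z^n) g = 1, as multiplication by z^n pads the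
    coefficients by n places and cancels all but the constant term. This single identity yields both
    the nonvanishing and the expansion. *)
Lemma has_expansion_inv_one_plus_pow (n : nat) :
  (1 <= n)%nat ->
  (forall z, in_disk z -> (1 + z ^ n)%C <> 0%C) /\
  has_expansion (fun z => / (1 + z ^ n))%C (alternating_coef n).
Proof.
  intros Hn.
  assert (Hmain : forall z, in_disk z -> exists g,
    is_Cseries (fun k => alternating_coef n k * z ^ k)%C g /\ ((1 + z ^ n) * g)%C = 1%C).
  { intros z Hz.
    destruct (ex_Cseries_le (fun k => alternating_coef n k * z ^ k)%C (fun k => Cmod z ^ k))
      as [g Hg].
    { intros k. rewrite Cmod_mult, Cmod_pow.
      assert (Hzk : 0 <= Cmod z ^ k) by (apply pow_le, Cmod_ge_0).
      unfold alternating_coef. destruct (k mod n =? 0)%nat.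
      - rewrite Cmod_pow, Cmod_opp, Cmod_1, pow1. lra.
      - rewrite Cmod_0. lra. }
    { apply ex_series_geom. rewrite Rabs_pos_eq; [exact Hz|apply Cmod_ge_0]. }
    exists g. split; [exact Hg|].
    assert (Hpad := is_Cseries_pad n _ _ (is_Cseries_scal (z ^ n)%C _ _ Hg)).
    assert (Hsum := is_Cseries_plus _ _ _ _ Hg Hpad).
    replace ((1 + z ^ n) * g)%C with (g + z ^ n * g)%C by ring.
    apply (is_Cseries_unique (fun k => (if (k =? 0)%nat then 1 else 0) * z ^ k)%C);
      [|apply is_Cseries_delta].
    revert Hsum. apply is_Cseries_ext. intros k.
    destruct (Nat.ltb_spec k n) as [Hk|Hk].
    - unfold alternating_coef. rewrite Nat.mod_small, Nat.div_small by exact Hk.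
      destruct (k =? 0)%nat; simpl; ring.
    - unfold alternating_coef.
      set (j := (k - n)%nat). assert (Ek : k = (j + 1 * n)%nat) by lia.
      clearbody j. subst k.
      rewrite Nat.Div0.mod_add, Nat.div_add by lia.
      replace (j + 1 * n =? 0)%nat with false by (symmetry; apply Nat.eqb_neq; lia).
      rewrite Nat.mul_1_l, Cpow_add_r.
      destruct (j mod n =? 0)%nat; [|ring].
      rewrite (Cpow_add_r z), Cpow_1_r. ring. }
  split.
  - intros z Hz E. destruct (Hmain z Hz) as [g [_ Hg]]. rewrite E, Cmult_0_l in Hg.
    apply C1_nz. symmetry. exact Hg.
  - intros z Hz. destruct (Hmain z Hz) as [g [Hg1 Hg2]]. apply is_pseries_Cseries.
    replace (/ (1 + z ^ n))%C with g; [exact Hg1|].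
    assert (Hne : (1 + z ^ n)%C <> 0%C)
      by (intros E; rewrite E, Cmult_0_l in Hg2; apply C1_nz; symmetry; exact Hg2).
    transitivity (/ (1 + z ^ n) * ((1 + z ^ n) * g))%C; [field; exact Hne|rewrite Hg2; ring].
Qed.

(* (1 - z^n) / (1 + z^n), in partial fractions *)
Definition extremal_p (n : nat) (z : C) : C := (2 * / (1 + z ^ n) - 1)%C.

Lemma extremal_p_class_P (n : nat) : (1 <= n)%nat -> class_P n (extremal_p n).
Proof.
  intros Hn. destruct (has_expansion_inv_one_plus_pow n Hn) as [Hne Hexp].
  assert (He : has_expansion (extremal_p n)
    (fun k => 2 * alternating_coef n k - (if (k =? 0)%nat then 1 else 0))%C).
  { intros z Hz. apply is_pseries_Cseries.
    assert (H := proj1 (is_pseries_Cseries _ _ _) (Hexp z Hz)).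
    generalize (is_Cseries_plus _ _ _ _ (is_Cseries_scal 2%C _ _ H)
      (is_Cseries_scal (-(1))%C _ _ (is_Cseries_delta z))).
    replace (2 * / (1 + z ^ n) + - (1) * 1)%C with (extremal_p n z) by (unfold extremal_p; ring).
    apply is_Cseries_ext. intros k. ring. }
  split; [exact (has_expansion_analytic _ _ He)|]. split.
  - eexists. split; [exact He|]. split.
    + unfold alternating_coef. rewrite Nat.Div0.mod_0_l, Nat.Div0.div_0_l. simpl. ring.
    + intros k Hk. unfold alternating_coef. rewrite Nat.mod_small by lia.
      replace (k =? 0)%nat with false by (symmetry; apply Nat.eqb_neq; lia). ring.
  - intros z Hz. unfold extremal_p. assert (Hv := Hne z Hz).
    assert (Hm : Cmod (z ^ n) < 1).
    { rewrite Cmod_pow. destruct n as [|n]; [lia|]. rewrite <- (pow1 (S n)).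
      apply pow_S_lt. split; [apply Cmod_ge_0|exact Hz]. }
    destruct (z ^ n)%C as [a b].
    assert (Hab : a ^ 2 + b ^ 2 < 1).
    { generalize (Cmod2_alt (a, b)) (Cmod_ge_0 (a, b)). simpl Re. simpl Im. nra. }
    assert (Hd : 0 < (1 + a) ^ 2 + b ^ 2) by nra.
    (* With v = z^n, the real part of (1 - v) / (1 + v) is (1 - |v|^2) / |1 + v|^2. *)
    replace (Re (2 * / (1 + (a, b)) - 1)%C)
      with ((1 - (a ^ 2 + b ^ 2)) / ((1 + a) ^ 2 + b ^ 2)).
    + apply Rdiv_lt_0_compat; lra.
    + simpl. field. simpl in *. lra.
Qed.

Lemma extremal_class_F (n : nat) :
  (1 <= n)%nat -> class_F n (fun z => z * extremal_p n z)%C.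
Proof.
  intros Hn. assert (HP := extremal_p_class_P n Hn).
  split; [|exists (extremal_p n); split; [exact HP|reflexivity]].
  destruct HP as [_ [[c [Hc [Hc0 Hck]]] _]].
  assert (He : has_expansion (fun z => z * extremal_p n z)%C
     (fun k => match k with O => 0%C | S j => c j end)).
  { intros z Hz. apply is_pseries_Cseries.
    replace (z * extremal_p n z)%C
      with ((fun k => match k with O => 0 | S j => c j end * z ^ k)%C 0%nat + z * extremal_p n z)%C
      by (simpl; ring).
    apply is_Cseries_shift.
    generalize (is_Cseries_scal z _ _ (proj1 (is_pseries_Cseries _ _ _) (Hc z Hz))).
    apply is_Cseries_ext. intros k. rewrite Cpow_S. ring. }
  split; [exact (has_expansion_analytic _ _ He)|].
  eexists. split; [exact He|]. split; [reflexivity|]. split; [exact Hc0|].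
  intros [|k] Hk; [reflexivity|]. apply Hck. lia.
Qed.

Lemma is_Cderive_extremal_p (n : nat) (z : C) :
  (1 + z ^ n)%C <> 0%C ->
  is_Cderive (extremal_p n) z (- (2 * INR n * z ^ (n - 1)) / ((1 + z ^ n) * (1 + z ^ n)))%C.
Proof.
  intros Hz. unfold extremal_p.
  replace (- (2 * INR n * z ^ (n - 1)) / ((1 + z ^ n) * (1 + z ^ n)))%C
    with (2 * (- / ((1 + z ^ n) * (1 + z ^ n)) * (0 + INR n * z ^ (n - 1))) + 0)%C
    by (field; exact Hz).
  apply (is_Cderive_plus (fun z => 2 * / (1 + z ^ n))%C (fun _ => - (1))%C);
    [|apply is_Cderive_const].
  apply is_Cderive_scal, (is_Cderive_comp Cinv (fun z => 1 + z ^ n)%C);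
    [apply is_Cderive_inv_id; exact Hz|].
  apply (is_Cderive_plus (fun _ => 1%C) (fun z => z ^ n)%C);
    [apply is_Cderive_const|apply is_Cderive_pow].
Qed.

Lemma extremal_dilate_not_class_S_wp (n : nat) (s r : R) :
  (1 <= n)%nat -> 0 < s < r -> r <= 1 -> 1 - (s ^ n) ^ 2 < 2 * INR n * s ^ n * exp 1 ->
  ~ class_S_wp (dilate r (fun z => z * extremal_p n z)%C).
Proof.
  intros Hn Hs Hr Hlt [_ [w [[_ [_ Hw]] H]]].
  set (sig := s ^ n) in *.
  assert (Hsig : 0 < sig < 1).
  { split; [apply pow_lt; lra|]. unfold sig. destruct n as [|m]; [lia|].
    rewrite <- (pow1 (S m)). apply pow_S_lt. lra. }
  (* Chosen so that r z = s, with s < r keeping z inside the disk. *)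
  set (z := RtoC (s / r)).
  assert (Hsr : 0 < s / r < 1).
  { split; [apply Rdiv_lt_0_compat; lra|]. apply Rmult_lt_reg_r with r; [lra|].
    unfold Rdiv. rewrite Rmult_assoc, Rinv_l; lra. }
  assert (Hz : in_disk z) by (unfold in_disk, z; rewrite Cmod_R, Rabs_pos_eq; lra).
  assert (Hz0 : z <> 0%C) by (intros E; apply RtoC_inj in E; lra).
  destruct (H z Hz Hz0) as [d [Hd [_ Heq]]].
  assert (Hrz : (RtoC r * z)%C = RtoC s).
  { unfold z. rewrite <- RtoC_mult. f_equal. field. lra. }
  assert (Hpow : (RtoC s ^ n)%C = RtoC sig) by (unfold sig; rewrite RtoC_pow; reflexivity).
  assert (N1 : (1 + RtoC sig)%C <> 0%C)
    by (rewrite <- RtoC_plus; intros E; apply RtoC_inj in E; lra).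
  assert (N2 : (1 - RtoC sig)%C <> 0%C)
    by (rewrite <- RtoC_minus; intros E; apply RtoC_inj in E; lra).
  assert (N3 : RtoC s <> 0%C) by (intros E; apply RtoC_inj in E; lra).
  assert (N4 : RtoC r <> 0%C) by (intros E; apply RtoC_inj in E; lra).
  assert (Hd' : is_Cderive (dilate r (fun z => z * extremal_p n z)%C) z
    (1 * extremal_p n (RtoC s)
      + RtoC s * (- (2 * INR n * RtoC s ^ (n - 1))
          / ((1 + RtoC s ^ n) * (1 + RtoC s ^ n))))%C).
  { apply is_Cderive_dilate; [lra|]. rewrite Hrz.
    apply (is_Cderive_mult (fun z => z)); [apply is_Cderive_id|].
    apply is_Cderive_extremal_p. rewrite Hpow. exact N1. }
  rewrite (is_Cderive_unique _ _ _ _ Hd Hd') in Heq.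
  assert (Hpow1 : (RtoC s ^ (n - 1))%C = (RtoC sig / RtoC s)%C).
  { rewrite <- Hpow. replace n with (S (n - 1)) at 2 by lia. rewrite Cpow_S. field. exact N3. }
  unfold dilate in Heq. rewrite Hrz in Heq. unfold extremal_p in Heq.
  rewrite Hpow1, Hpow in Heq.
  assert (Hval : (w z * Cexp (w z))%C = RtoC (- (2 * INR n * sig / (1 - sig ^ 2)))).
  { assert (E : (w z * Cexp (w z))%C = (wp (w z) - 1)%C) by (unfold wp; ring).
    rewrite E, <- Heq. replace z with (RtoC s / RtoC r)%C by (unfold z; rewrite RtoC_div; [reflexivity|lra]).
    replace (1 - sig ^ 2) with ((1 - sig) * (1 + sig)) by ring.
    rewrite RtoC_opp, RtoC_div by nra. rewrite !RtoC_mult, RtoC_minus, RtoC_plus.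
    field. repeat split; auto. }
  assert (Hge := real_value_ge_of_in_disk (w z) _ (Hw z Hz) Hval).
  assert (Hee : exp 1 * exp (- 1) = 1) by (rewrite <- exp_plus, Rplus_opp_r; apply exp_0).
  assert (He := exp_pos 1).
  assert (H1 : 0 < 1 - sig ^ 2) by nra.
  assert (H2 : 2 * INR n * sig / (1 - sig ^ 2) <= exp (- 1)) by lra.
  apply Rmult_le_compat_r with (r := (1 - sig ^ 2) * exp 1) in H2;
    [|apply Rmult_le_pos; lra].
  replace (2 * INR n * sig / (1 - sig ^ 2) * ((1 - sig ^ 2) * exp 1))
    with (2 * INR n * sig * exp 1) in H2 by (field; lra).
  replace (exp (- 1) * ((1 - sig ^ 2) * exp 1)) with ((exp 1 * exp (- 1)) * (1 - sig ^ 2)) in H2 by ring.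
  rewrite Hee in H2. lra.
Qed.

(** Both radii come from one argument: membership is proved for the smaller class [class_S_wp_n n],
    failure for the larger class [class_S_wp]. *)
Lemma is_radius_of_equation (n : nat) (r0 : R) :
  (1 <= n)%nat -> 0 < r0 <= 1 -> 2 * INR n * r0 ^ n * exp 1 = 1 - (r0 ^ n) ^ 2 ->
  is_radius (class_S_wp_n n) (class_F n) r0 /\ is_radius class_S_wp (class_F n) r0.
Proof.
  intros Hn Hr0 Heq. assert (He := exp_pos 1).
  assert (HN : 1 <= INR n) by (apply (le_INR 1); exact Hn).
  assert (Hpos : radius_prop (class_S_wp_n n) (class_F n) r0).
  { intros r Hr f Hf. apply class_S_wp_n_dilate; auto; [lra|].
    assert (0 < r ^ n <= r0 ^ n) by (split; [apply pow_lt; lra|apply pow_incr; lra]).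
    assert (2 * INR n * r ^ n * exp 1 <= 2 * INR n * r0 ^ n * exp 1)
      by (apply Rmult_le_compat_r; [lra|]; apply Rmult_le_compat_l; lra).
    assert ((r ^ n) ^ 2 <= (r0 ^ n) ^ 2) by (apply pow_incr; lra). lra. }
  assert (Hneg : forall r1, r0 < r1 <= 1 -> ~ radius_prop class_S_wp (class_F n) r1).
  { intros r1 Hr1 H.
    (* The midpoint lies beyond r0, where the inequality is already violated, and strictly inside
       the disk of radius r1. *)
    apply (extremal_dilate_not_class_S_wp n ((r0 + r1) / 2) r1 Hn); [lra|lra| |].
    - assert (Hlt : r0 ^ n < ((r0 + r1) / 2) ^ n)
        by (destruct n as [|m]; [lia|]; apply pow_S_lt; lra).
      assert (Hp : 0 < r0 ^ n) by (apply pow_lt; lra).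
      set (a := r0 ^ n) in *. set (b := ((r0 + r1) / 2) ^ n) in *.
      assert (2 * INR n * a * exp 1 < 2 * INR n * b * exp 1)
        by (apply Rmult_lt_compat_r; [lra|]; apply Rmult_lt_compat_l; lra).
      nra.
    - apply H; [lra|]. apply extremal_class_F; exact Hn. }
  split; (split; [exact Hr0|]); split.
  - exact Hpos.
  - intros r1 Hr1 H. apply (Hneg r1 Hr1). intros r Hr f Hf. apply (H r Hr f Hf).
  - intros r Hr f Hf. apply (Hpos r Hr f Hf).
  - exact Hneg.
Qed.

(** To be used with x = n e: rho is the positive root of t^2 + 2 x t - 1. *)
Lemma radius_equation_root (x : R) :
  0 < x -> let rho := sqrt (1 + x ^ 2) - x in 0 < rho < 1 /\ 2 * x * rho = 1 - rho ^ 2.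
Proof.
  intros Hx rho.
  assert (Hs := sqrt_sqrt (1 + x ^ 2) ltac:(nra)).
  assert (Hp := sqrt_pos (1 + x ^ 2)). unfold rho.
  set (s := sqrt (1 + x ^ 2)) in *. repeat split; nra.
Qed.

Theorem mainTheorem7 :
  (forall n : nat, (1 <= n)%nat ->
    is_radius (class_S_wp_n n) (class_F n)
      (Rpower (sqrt (1 + (INR n)^2 * (exp 1)^2) - INR n * exp 1) (/ INR n))) /\
  is_radius class_S_wp (class_F 1) (sqrt (1 + (exp 1)^2) - exp 1).
Proof.
  assert (He := exp_pos 1).
  split.
  - intros n Hn. assert (HN : 1 <= INR n) by (apply (le_INR 1); exact Hn).
    destruct (radius_equation_root (INR n * exp 1)) as [H1 H2]; [nra|].
    rewrite <- Rpow_mult_distr.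
    set (rho := sqrt (1 + (INR n * exp 1) ^ 2) - INR n * exp 1) in *.
    set (r0 := Rpower rho (/ INR n)).
    assert (Hr0 : 0 < r0) by apply exp_pos.
    assert (Hr0n : r0 ^ n = rho).
    { rewrite <- Rpower_pow by exact Hr0. unfold r0. rewrite Rpower_mult, Rinv_l by lra.
      apply Rpower_1. lra. }
    apply is_radius_of_equation; [exact Hn| |rewrite Hr0n; lra].
    (* If r0 > 1, then r0^n >= 1, whereas r0^n = rho < 1. *)
    split; [exact Hr0|]. apply Rnot_lt_le. intros Hlt.
    assert (H := pow_R1_Rle r0 n ltac:(lra)). lra.
  - destruct (radius_equation_root (exp 1) He) as [H1 H2].
    apply is_radius_of_equation; [lia|lra|]. simpl INR. rewrite pow_1. lra.
Qed.
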